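(* Let $R$ be a commutative ring, let $\sigma$ be an automorphism of $R$ such that for every $\mathfrak{m}\in\operatorname{Max}(R)$ and every $s\in R$, if $s\notin\mathfrak{m}$ then $\sigma(s)\notin\mathfrak{m}$, and let $A:=R[x_1,\dots,x_n;\sigma]$. Let $M$ be a finitely presented left $A$-module. Then $M$ is extended from $R$ if and only if, for every $\mathfrak{m}\in\operatorname{Max}(R)$, the $A_{\mathfrak{m}}$-module $M_{\mathfrak{m}}:=A_{\mathfrak{m}}\otimes_A M$ is extended from $R_{\mathfrak{m}}$.
   Context: $A=R[x_1,\dots,x_n;\sigma]$ denotes the Ore extension of $R$ in variables $x_1,\dots,x_n$ with $x_ix_j=x_jx_i$ and $x_ir=\sigma(r)x_i$ for all $i,j$ and all $r\in R$; it is a free left $R$-module on the monomials $x_1^{\alpha_1}\cdots x_n^{\alpha_n}$. All modules are left modules. For rings $T\supseteq S$, a $T$-module $M$ is extended from $S$ if there is an $S$-module $M_0$ with $M\cong T\otimes_S M_0$ as $T$-modules. $\operatorname{Max}(R)$ is the set of maximal ideals of $R$. For $\mathfrak{m}\in\operatorname{Max}(R)$, $A_{\mathfrak{m}}:=S^{-1}A\cong R_{\mathfrak{m}}[x_1,\dots,x_n;\overline{\sigma}]$ with $S=R\setminus\mathfrak{m}$ and $\overline{\sigma}(r/s)=\sigma(r)/\sigma(s)$ (well defined by the hypothesis on $\sigma$), with the same commutation rules for the variables. *)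

(* Defs.v *)
From HB Require Import structures.
From mathcomp Require Import all_boot all_algebra finmap.
From mathcomp Require Import ring.
From mathcomp Require Import boolp.
From mathcomp Require Import monalg.

Set Implicit Arguments.
Unset Strict Implicit.
Unset Printing Implicit Defensive.

Import GRing.Theory.

Local Open Scope ring_scope.
Local Open Scope quotient_scope.

HB.lock Definition freelift (K : choiceType) (V : zmodType) (f : K -> V)
    (x : {malg int[K]}) : V :=
  \sum_(k <- msupp x) f k *~ x@_k.

Arguments freelift {K V} f x.

Section FreeAbelianGroup.
Context (K : choiceType) (V : zmodType).

Lemma freeliftEw (f : K -> V) (d : {fset K}) x :
  fsubset (msupp x) d -> freelift f x = \sum_(k <- d) f k *~ x@_k.
Proof.
move=> le; rewrite freelift.unlock (big_fset_incl _ le) //= => k _.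
move/mcoeff_outdom->.
by rewrite mulr0z.
Qed.

Fact freelift_is_zmod_morphism (f : K -> V) : zmod_morphism (freelift f).
Proof.
move=> x y; pose d := fsetU (msupp x) (msupp y).
rewrite (@freeliftEw f d x) ?fsubsetUl // (@freeliftEw f d y) ?fsubsetUr //.
rewrite (@freeliftEw f d (x - y)) ?msuppB_le // -sumrB.
by apply: eq_bigr => k _; rewrite mcoeffB mulrzBr.
Qed.

HB.instance Definition _ (f : K -> V) :=
  GRing.isZmodMorphism.Build {malg int[K]} V (freelift f)
    (freelift_is_zmod_morphism f).

Lemma freeliftU (f : K -> V) k : freelift f << k >> = f k.
Proof.
rewrite (freeliftEw f (msuppU_le (k := k) (x := 1))) big_seq_fset1.
by rewrite mcoeffUU mulr1z.
Qed.

End FreeAbelianGroup.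

Lemma free_ind (K : choiceType) (P : {malg int[K]} -> Prop) :
  P 0 -> (forall x y, P x -> P y -> P (x - y)) -> (forall k, P << k >>) ->
  forall x, P x.
Proof.
move=> P0 PB PU x.
have PN y : P y -> P (- y) by move=> Py; rewrite -sub0r; apply: PB.
have PD y z : P y -> P z -> P (y + z).
  by move=> Py Pz; rewrite -[z]opprK; apply: PB => //; apply: PN.
rewrite [x]monalgE; elim/big_ind: _ => // k _.
have PUn j : P << (j%:Z : int) *g k >>.
  elim: j => [|j IHj]; first by rewrite monalgU0.
  by rewrite -addn1 PoszD monalgUD; apply: PD.
case: (x@_k) => j; first exact: PUn.
by rewrite NegzE monalgUN; apply: PN.
Qed.

(* T (x)_S M, with T a right S-module through phi, as the quotient of the
   free abelian group on T * M by the subgroup tensor_rel. *)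

Section Tensor.
Context {S T : pzRingType} (phi : {rmorphism S -> T}) (M : lmodType S).

Local Notation free := {malg int[(T * M)%type]}.

Inductive tensor_rel : free -> Prop :=
| tensor_rel0 : tensor_rel 0
| tensor_relB x y : tensor_rel x -> tensor_rel y -> tensor_rel (x - y)
| tensor_relDl t t' m :
    tensor_rel (<< (t + t', m) >> - (<< (t, m) >> + << (t', m) >>))
| tensor_relDr t m m' :
    tensor_rel (<< (t, m + m') >> - (<< (t, m) >> + << (t, m') >>))
| tensor_relZ t s m :
    tensor_rel (<< (t * phi s, m) >> - << (t, s *: m) >>).

Definition tensor_null : pred free := fun x => `[< tensor_rel x >].

Lemma tensor_nullP x : reflect (tensor_rel x) (x \in tensor_null).
Proof. exact: asboolP. Qed.

Fact tensor_null_zmod_closed : zmod_closed tensor_null.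
Proof.
split=> [|x y /tensor_nullP xN /tensor_nullP yN]; apply/tensor_nullP.
  exact: tensor_rel0.
exact: tensor_relB.
Qed.

HB.instance Definition _ :=
  GRing.isZmodClosed.Build free tensor_null tensor_null_zmod_closed.

Local Notation quot :=
  (Quotient.quot (GRing.ZmodClosed.clone free tensor_null _)).

Definition tensor : Type := quot.

HB.instance Definition _ := GRing.Zmodule.on tensor.

Definition pure (t : T) (m : M) : tensor :=
  \pi_quot << (t, m) >>.

Definition tensor_pi (x : free) : tensor :=
  \pi_quot x.

Fact tensor_pi_is_zmod_morphism : zmod_morphism tensor_pi.
Proof. by move=> x y; rewrite /tensor_pi raddfB. Qed.

HB.instance Definition _ :=
  GRing.isZmodMorphism.Build free tensor tensor_pi tensor_pi_is_zmod_morphism.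

Lemma tensor_pi_eq x y : tensor_rel (x - y) <-> tensor_pi x = tensor_pi y.
Proof.
split=> [xy|/eqP].
  by apply/eqP; rewrite -Quotient.idealrBE; apply/tensor_nullP.
by rewrite -Quotient.idealrBE => /tensor_nullP.
Qed.

Lemma tensor_pi0 x : tensor_rel x -> tensor_pi x = 0.
Proof.
by move=> xN; rewrite -(raddf0 tensor_pi); apply/tensor_pi_eq; rewrite subr0.
Qed.

Lemma tensor_pi_surj x : exists y, x = tensor_pi y.
Proof. by exists (repr x); rewrite /tensor_pi reprK. Qed.

Definition free_act (a : T) : free -> free :=
  freelift (fun k => << (a * k.1, k.2) >>).

HB.instance Definition _ a :=
  GRing.isZmodMorphism.Build free free (free_act a)
    (freelift_is_zmod_morphism _).

Lemma free_actU a t m : free_act a << (t, m) >> = << (a * t, m) >>.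
Proof. by rewrite /free_act freeliftU. Qed.

Lemma free_actM a b x : free_act a (free_act b x) = free_act (a * b) x.
Proof.
elim/free_ind: x => [|x y IHx IHy|[t m]]; first by rewrite !raddf0.
  by rewrite !raddfB /= IHx IHy.
by rewrite !free_actU mulrA.
Qed.

Lemma free_act1 x : free_act 1 x = x.
Proof.
elim/free_ind: x => [|x y IHx IHy|[t m]]; first by rewrite raddf0.
  by rewrite raddfB /= IHx IHy.
by rewrite free_actU mul1r.
Qed.

Lemma free_act_rel a x : tensor_rel x -> tensor_rel (free_act a x).
Proof.
elim=> [|{}x y _ IHx _ IHy|t t' m|t m m'|t s m].
- by rewrite raddf0; apply: tensor_rel0.
- by rewrite raddfB /=; apply: tensor_relB.
- by rewrite raddfB raddfD /= !free_actU mulrDr; apply: tensor_relDl.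
- by rewrite raddfB raddfD /= !free_actU; apply: tensor_relDr.
- by rewrite raddfB /= !free_actU mulrA; apply: tensor_relZ.
Qed.

Lemma free_act_relD a b x :
  tensor_rel (free_act (a + b) x - (free_act a x + free_act b x)).
Proof.
elim/free_ind: x => [|x y IHx IHy|[t m]].
- by rewrite !raddf0 addr0 subrr; apply: tensor_rel0.
- rewrite !raddfB /=.
  have E (u u' u'' v v' v'' : free) :
      u - v - (u' - v' + (u'' - v'')) = (u - (u' + u'')) - (v - (v' + v'')).
    rewrite (addrACA u') -(opprD v') !opprB (addrACA u) (addrACA u (- _)).
    by rewrite (addrC (- v)).
  by rewrite E; apply: tensor_relB.
- by rewrite !free_actU mulrDl; apply: tensor_relDl.
Qed.

Definition tensor_scale (a : T) (x : tensor) : tensor :=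
  tensor_pi (free_act a (repr x)).

Lemma tensor_scaleE a x :
  tensor_scale a (tensor_pi x) = tensor_pi (free_act a x).
Proof.
apply/tensor_pi_eq; rewrite -raddfB; apply: free_act_rel.
by apply/tensor_pi_eq; rewrite /tensor_pi reprK.
Qed.

Fact tensor_scaleA a b x :
  tensor_scale a (tensor_scale b x) = tensor_scale (a * b) x.
Proof.
have [y ->] := tensor_pi_surj x.
rewrite (tensor_scaleE b) (tensor_scaleE a) (tensor_scaleE (a * b)).
by rewrite free_actM.
Qed.

Fact tensor_scale1 : left_id 1 tensor_scale.
Proof.
move=> x; have [y ->] := tensor_pi_surj x.
by rewrite (tensor_scaleE 1) free_act1.
Qed.

Fact tensor_scaleDr : right_distributive tensor_scale +%R.
Proof.
move=> a x y; have [u ->] := tensor_pi_surj x; have [v ->] := tensor_pi_surj y.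
have -> : tensor_pi u + tensor_pi v = tensor_pi (u + v) by rewrite raddfD.
rewrite (tensor_scaleE a) (tensor_scaleE a) (tensor_scaleE a).
by rewrite (raddfD (free_act a)) (raddfD tensor_pi).
Qed.

Fact tensor_scaleDl x : {morph tensor_scale^~ x : a b / a + b}.
Proof.
move=> a b; have [y ->] := tensor_pi_surj x.
rewrite (tensor_scaleE a) (tensor_scaleE b) (tensor_scaleE (a + b)).
apply: etrans (raddfD tensor_pi _ _).
by apply/tensor_pi_eq; exact: free_act_relD.
Qed.

HB.instance Definition _ := GRing.Zmodule_isLmodule.Build T tensor
  tensor_scaleA tensor_scale1 tensor_scaleDr tensor_scaleDl.

Lemma pureDl t t' m : pure (t + t') m = pure t m + pure t' m.
Proof. by rewrite -raddfD; apply/tensor_pi_eq/tensor_relDl. Qed.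

Lemma pureDr t m m' : pure t (m + m') = pure t m + pure t m'.
Proof. by rewrite -raddfD; apply/tensor_pi_eq/tensor_relDr. Qed.

Lemma pure_balanced t s m : pure (t * phi s) m = pure t (s *: m).
Proof. exact/tensor_pi_eq/tensor_relZ. Qed.

Lemma pureZ a t m : a *: pure t m = pure (a * t) m.
Proof. by rewrite [LHS]tensor_scaleE free_actU. Qed.

Lemma tensor_ind (P : tensor -> Prop) :
  P 0 -> (forall x y, P x -> P y -> P (x - y)) -> (forall t m, P (pure t m)) ->
  forall x, P x.
Proof.
move=> P0 PB Pp x; have [{}x ->] := tensor_pi_surj x.
elim/free_ind: x => [|x y Px Py|[t m]].
- by rewrite raddf0.
- by rewrite raddfB; apply: PB.
- exact: Pp.
Qed.

(* Uniqueness of g follows from tensor_ind. *)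
Lemma tensor_lift (N : lmodType T) (f : {additive M -> N}) :
  (forall s m, f (s *: m) = phi s *: f m) ->
  exists g : {linear tensor -> N}, forall t m, g (pure t m) = t *: f m.
Proof.
move=> fZ; pose h := freelift (fun k : T * M => k.1 *: f k.2).
have h0 x : tensor_rel x -> h x = 0.
  rewrite /h; elim=> [|{}x y _ IHx _ IHy|t t' m|t m m'|t s m].
  - by rewrite raddf0.
  - by rewrite raddfB /= IHx IHy subrr.
  - by rewrite raddfB raddfD /= !freeliftU /= scalerDl subrr.
  - by rewrite raddfB raddfD /= !freeliftU /= raddfD scalerDr subrr.
  - by rewrite raddfB /= !freeliftU /= fZ scalerA subrr.
pose g (x : tensor) : N := h (repr x).
have gE x : g (tensor_pi x) = h x.
  apply/eqP; rewrite -subr_eq0 /g /h -raddfB; apply/eqP/h0.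
  by apply/tensor_pi_eq; rewrite /tensor_pi reprK.
have gB : zmod_morphism g.
  move=> x y; have [{}x ->] := tensor_pi_surj x.
  have [{}y ->] := tensor_pi_surj y.
  by rewrite -raddfB !gE /h raddfB.
have gZ : scalable g.
  move=> a x; have [y ->] := tensor_pi_surj x.
  have -> : a *: tensor_pi y = tensor_pi (free_act a y) := tensor_scaleE a y.
  rewrite !gE /h; elim/free_ind: y => [|y z IHy IHz|[t m]].
  - by rewrite !raddf0.
  - by rewrite !raddfB /= IHy IHz.
  - by rewrite free_actU !freeliftU /= scalerA.
pose gaM := GRing.isZmodMorphism.Build tensor N g gB.
pose gsM := GRing.isScalable.Build T tensor N *:%R g gZ.
pose gL : {linear tensor -> N} := HB.pack g gaM gsM.
by exists gL => t m; rewrite /= /pure gE /h freeliftU.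
Qed.

End Tensor.

Definition module_iso (T : pzRingType) (M N : lmodType T) : Prop :=
  exists f : {linear M -> N}, bijective f.

Definition extended_from (S T : pzRingType) (phi : {rmorphism S -> T})
    (M : lmodType T) : Prop :=
  exists M0 : lmodType S, module_iso M (tensor phi M0).

(* An exact sequence A^p -> A^q -> M -> 0 of left modules: the scalars act on
   row vectors from the left, so that right multiplication by K is linear. *)
Definition finitely_presented (A : pzRingType) (M : lmodType A) : Prop :=
  exists (p q : nat) (K : 'M[A]_(p, q)) (f : {linear 'rV[A]_q -> M}),
    (forall m, exists v, f v = m) /\
    (forall v, f v = 0 <-> exists u : 'rV[A]_p, v = u *m K).

(* R[x_1, ..., x_n; sigma] as the finitely supported R-valued functions on the
   commutative monomials in n variables. The parameter sigma only matters for
   the product, (c x^a) (d x^b) = c sigma^|a|(d) x^(a + b), where oreU c a is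
   c x^a. *)
Definition ore (R : pzRingType) (n : nat) (sigma : {rmorphism R -> R}) : Type :=
  {malg R[{cmonom 'I_n}]}.

HB.lock Definition oreU (R : pzRingType) (n : nat) (sigma : {rmorphism R -> R})
    (c : R) (a : {cmonom 'I_n}) : ore n sigma := << c *g a >>.

HB.lock Definition oremul (R : pzRingType) (n : nat)
    (sigma : {rmorphism R -> R}) (f g : ore n sigma) : ore n sigma :=
  \sum_(a <- msupp f) \sum_(b <- msupp g)
     << f@_a * iter (mdeg a) sigma g@_b *g mmul a b >>.

Arguments oreU {R n} sigma c a.
Arguments oremul {R n sigma} f g.

Section OreRing.
Context (R : pzRingType) (n : nat) (sigma : {rmorphism R -> R}).

Local Notation A := (ore n sigma).
Local Notation K := {cmonom 'I_n}.
Local Notation omul := (@oremul R n sigma).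

HB.instance Definition _ := GRing.Zmodule.on A.

Implicit Types (f g h : A) (a b : K) (c d : R).

Definition oreone : A := oreU sigma 1 mone.

Lemma iter_sigma0 k : iter k sigma 0 = 0.
Proof. by elim: k => //= k ->; rewrite rmorph0. Qed.
Lemma iter_sigma1 k : iter k sigma 1 = 1.
Proof. by elim: k => //= k ->; rewrite rmorph1. Qed.
Lemma iter_sigmaD k : {morph iter k sigma : x y / x + y}.
Proof. by move=> x y; elim: k => //= k ->; rewrite rmorphD. Qed.
Lemma iter_sigmaM k : {morph iter k sigma : x y / x * y}.
Proof. by move=> x y; elim: k => //= k ->; rewrite rmorphM. Qed.

Lemma oremulEw (d1 d2 : {fset K}) f g :
  fsubset (msupp f) d1 -> fsubset (msupp g) d2 ->
  omul f g = \sum_(a <- d1) \sum_(b <- d2)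
     << f@_a * iter (mdeg a) sigma g@_b *g mmul a b >>.
Proof.
move=> le1 le2; rewrite oremul.unlock (big_fset_incl _ le1) /=.
  apply/eq_bigr=> a _; apply/big_fset_incl => // b _ /mcoeff_outdom ->.
  by rewrite iter_sigma0 mulr0 monalgU0.
move=> a _ /mcoeff_outdom fa; rewrite big1 // => b _.
by rewrite fa mul0r monalgU0.
Qed.

Lemma oremulUU c d a b :
  omul (oreU sigma c a) (oreU sigma d b) =
  oreU sigma (c * iter (mdeg a) sigma d) (mmul a b).
Proof.
by rewrite oreU.unlock (oremulEw msuppU_le msuppU_le) !big_seq_fset1 !mcoeffUU.
Qed.

Lemma oremulDl : left_distributive omul +%R.
Proof.
move=> f1 f2 g; pose d := fsetU (msupp f1) (msupp f2).
rewrite (@oremulEw d (msupp g) f1) ?fsubsetUl ?fsubset_refl //.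
rewrite (@oremulEw d (msupp g) f2) ?fsubsetUr ?fsubset_refl //.
rewrite (@oremulEw d (msupp g) (f1 + f2)) ?msuppD_le ?fsubset_refl //.
rewrite -big_split /=.
apply/eq_bigr=> a _; rewrite -big_split /=; apply/eq_bigr=> b _.
by rewrite mcoeffD mulrDl monalgUD.
Qed.

Lemma oremulDr : right_distributive omul +%R.
Proof.
move=> f g1 g2; pose d := fsetU (msupp g1) (msupp g2).
rewrite (@oremulEw (msupp f) d f g1) ?fsubsetUl ?fsubset_refl //.
rewrite (@oremulEw (msupp f) d f g2) ?fsubsetUr ?fsubset_refl //.
rewrite (@oremulEw (msupp f) d f (g1 + g2)) ?msuppD_le ?fsubset_refl //.
rewrite -big_split /=.
apply/eq_bigr=> a _; rewrite -big_split /=; apply/eq_bigr=> b _.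
by rewrite mcoeffD iter_sigmaD mulrDr monalgUD.
Qed.

Lemma oremul0l : left_zero 0 omul.
Proof. by move=> g; rewrite oremul.unlock msupp0 big_seq_fset0. Qed.

Lemma oremul0r : right_zero 0 omul.
Proof.
move=> g; rewrite oremul.unlock big1 // => a _.
by rewrite msupp0 big_seq_fset0.
Qed.

Lemma oreU_coeff c a b : (oreU sigma c a)@_b = c *+ (a == b).
Proof. by rewrite oreU.unlock mcoeffU. Qed.

Lemma oreU_expand f : f = \sum_(a <- msupp f) oreU sigma f@_a a.
Proof. by rewrite {1}[f]monalgE oreU.unlock. Qed.

Lemma ore_ind (P : A -> Prop) :
  P 0 -> (forall f g, P f -> P g -> P (f + g)) ->
  (forall c a, P (oreU sigma c a)) ->
  forall f, P f.
Proof. by move=> P0 PD PU f; rewrite [f]oreU_expand; elim/big_ind: _. Qed.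

Fact oremulA : associative omul.
Proof.
move=> f g h; elim/ore_ind: f => [|f f' IH IH'|c a].
- by rewrite !oremul0l.
- by rewrite !oremulDl IH IH'.
elim/ore_ind: g => [|g g' IH IH'|d b].
- by rewrite oremul0r !oremul0l oremul0r.
- by rewrite oremulDr !oremulDl oremulDr IH IH'.
elim/ore_ind: h => [|h h' IH IH'|e k].
- by rewrite !oremul0r.
- by rewrite !oremulDr IH IH'.
by rewrite !oremulUU iter_sigmaM mdegM iterD mulrA mulmA.
Qed.

Fact oremul1l : left_id oreone omul.
Proof.
move=> f; elim/ore_ind: f => [|f g IHf IHg|c a]; first exact: oremul0r.
  by rewrite oremulDr IHf IHg.
by rewrite oremulUU mdeg1 mul1r mul1m.
Qed.

Fact oremul1r : right_id oreone omul.
Proof.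
move=> f; elim/ore_ind: f => [|f g IHf IHg|c a]; first exact: oremul0l.
  by rewrite oremulDl IHf IHg.
by rewrite oremulUU iter_sigma1 mulr1 mulm1.
Qed.

HB.instance Definition _ := GRing.Zmodule_isPzRing.Build A
  oremulA oremul1l oremul1r oremulDl oremulDr.

Lemma oreUM c d a b :
  oreU sigma c a * oreU sigma d b =
  oreU sigma (c * iter (mdeg a) sigma d) (mmul a b).
Proof. exact: oremulUU. Qed.

Definition oreC (c : R) : A := oreU sigma c mone.
Definition oreX (i : 'I_n) : A := oreU sigma 1 (ucm i).

Fact oreC_is_zmod_morphism : zmod_morphism oreC.
Proof. by move=> c d; rewrite /oreC oreU.unlock monalgUB. Qed.

Fact oreC_is_monoid_morphism : monoid_morphism oreC.
Proof. by split=> // c d; rewrite /oreC oreUM mdeg1 mulm1. Qed.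

HB.instance Definition _ :=
  GRing.isZmodMorphism.Build R A oreC oreC_is_zmod_morphism.
HB.instance Definition _ :=
  GRing.isMonoidMorphism.Build R A oreC oreC_is_monoid_morphism.

Lemma oreCU c d a : oreC c * oreU sigma d a = oreU sigma (c * d) a.
Proof. by rewrite oreUM mdeg1 mul1m. Qed.

Lemma oreC_coeff c f a : (oreC c * f)@_a = c * f@_a.
Proof.
elim/ore_ind: f => [|f g IHf IHg|d b].
- by rewrite mulr0 mcoeff0 mulr0.
- by rewrite mulrDr !mcoeffD IHf IHg mulrDr.
- by rewrite oreCU !oreU_coeff mulrnAr.
Qed.

Lemma oreXX i j : oreX i * oreX j = oreX j * oreX i.
Proof. by rewrite !oreUM !iter_sigma1 mulmC. Qed.

Lemma oreXC i r : oreX i * oreC r = oreC (sigma r) * oreX i.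
Proof. by rewrite oreCU oreUM mdegU /= mul1r mulr1 mulm1. Qed.

Lemma ore_monomE (a : K) : \prod_(i < n) oreX i ^+ a i = oreU sigma 1 a.
Proof.
have XnE i k : oreX i ^+ k = oreU sigma 1 (expcmn (ucm i) k).
  elim: k => [|k IHk]; first by [].
  rewrite exprS IHk oreUM iter_sigma1 mulr1; congr oreU.
  by case: k {IHk} => [|k] //; rewrite mulm1.
transitivity (oreU sigma 1 (\big[mmul/mone]_(i < n) expcmn (ucm i) (a i))).
  elim/big_rec2: _ => [|i k f _ ->]; first by [].
  by rewrite XnE oreUM iter_sigma1 mulr1.
congr oreU; apply/eqP/cmP => j.
have expE i k : expcmn (ucm i) k j = ((i == j) * k)%N.
  elim: k => [|k IHk]; first by rewrite muln0; apply: onecmE.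
  case: k IHk => [|k] IHk; first by rewrite muln1; apply: ucmE.
  have -> : expcmn (ucm i) k.+2 = mulcm (ucm i) (expcmn (ucm i) k.+1) by [].
  by rewrite mulcmE IHk ucmE (mulnS _ k.+1).
rewrite (big_morph (fun m : K => m j) (id1 := 0%N) (op1 := addn)); last first.
- exact: cm1.
- by move=> u v; apply: cmM.
rewrite (bigD1 j) //= expE eqxx mul1n big1 ?addn0 // => i /negbTE ij.
by rewrite expE ij.
Qed.

Lemma ore_expand f :
  f = \sum_(a <- msupp f) oreC f@_a * \prod_(i < n) oreX i ^+ a i.
Proof.
rewrite {1}[f]oreU_expand; apply: eq_bigr => a _.
by rewrite ore_monomE oreCU mulr1.
Qed.

Lemma ore_free (d : {fset K}) (c : K -> R) :
  \sum_(a <- d) oreC (c a) * \prod_(i < n) oreX i ^+ a i = 0 ->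
  forall a, a \in d -> c a = 0.
Proof.
move=> s0 a ad; have := congr1 (mcoeff a) s0.
rewrite raddf_sum /= mcoeff0 (big_fsetD1 a) //= big1_fset => [|b]; last first.
  rewrite in_fsetD1 => /andP[/negbTE ba _] _.
  by rewrite ore_monomE oreCU oreU_coeff ba.
by rewrite ore_monomE oreCU oreU_coeff eqxx mulr1 addr0.
Qed.

End OreRing.

Arguments oreC {R} n sigma c.
Arguments oreX {R n} sigma i.

Section OreMap.
Context (R R' : pzRingType) (n : nat).
Context (sigma : {rmorphism R -> R}) (sigma' : {rmorphism R' -> R'}).
Context (theta : {rmorphism R -> R'}).
Context (thetaS : forall r, theta (sigma r) = sigma' (theta r)).

Definition ore_map_fun (f : ore n sigma) : ore n sigma' :=
  \sum_(a <- msupp f) oreU sigma' (theta f@_a) a.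

Lemma ore_map_coeff f a : (ore_map_fun f)@_a = theta f@_a.
Proof.
rewrite /ore_map_fun raddf_sum /=; case: (msuppP f a) => [af|naf].
  rewrite (big_fsetD1 a) //= oreU_coeff eqxx big1_fset ?addr0 // => b.
  by rewrite in_fsetD1 oreU_coeff => /andP[/negbTE->].
rewrite rmorph0 big1_fset // => b bf _; rewrite oreU_coeff.
by case: eqP => // ba; rewrite ba (negbTE naf) in bf.
Qed.

Lemma ore_mapU c a : ore_map_fun (oreU sigma c a) = oreU sigma' (theta c) a.
Proof.
apply/malgP => b; rewrite ore_map_coeff !oreU_coeff.
by case: eqP => // _; rewrite rmorph0.
Qed.

Fact ore_map_is_zmod_morphism : zmod_morphism ore_map_fun.
Proof.
move=> f g; apply/malgP => a.
by rewrite mcoeffB !ore_map_coeff mcoeffB rmorphB.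
Qed.

HB.instance Definition _ := GRing.isZmodMorphism.Build
  (ore n sigma) (ore n sigma') ore_map_fun ore_map_is_zmod_morphism.

Fact ore_map_is_monoid_morphism : monoid_morphism ore_map_fun.
Proof.
split=> [|f g]; first by rewrite [LHS]ore_mapU rmorph1.
have thetaI k r : theta (iter k sigma r) = iter k sigma' (theta r).
  by elim: k => //= k <-.
elim/ore_ind: f => [|f f' IH IH'|c a].
- by rewrite mul0r !raddf0 mul0r.
- by rewrite mulrDl !raddfD /= IH IH' mulrDl.
elim/ore_ind: g => [|g g' IH IH'|d b].
- by rewrite mulr0 !raddf0 mulr0.
- by rewrite mulrDr !raddfD /= IH IH' mulrDr.
by rewrite oreUM !ore_mapU oreUM rmorphM thetaI.
Qed.

Definition ore_map : {rmorphism ore n sigma -> ore n sigma'} :=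
  HB.pack ore_map_fun
    (GRing.isZmodMorphism.Build _ _ ore_map_fun ore_map_is_zmod_morphism)
    (GRing.isMonoidMorphism.Build _ _ ore_map_fun ore_map_is_monoid_morphism).

End OreMap.

Section Localization.
Context (R : comPzRingType) (S : mulrClosed R).

Definition frac : Type := (R * {s : R | s \in S})%type.

HB.instance Definition _ := Choice.on frac.

Implicit Types (x y z : frac).

Definition frac_eq x y : bool :=
  `[< exists2 u, u \in S & u * (x.1 * sval y.2) = u * (y.1 * sval x.2) >].

Lemma frac_eqP x y :
  reflect (exists2 u, u \in S & u * (x.1 * sval y.2) = u * (y.1 * sval x.2))
          (frac_eq x y).
Proof. exact: asboolP. Qed.

Fact frac_eq_equiv : equiv_class_of frac_eq.
Proof.
split=> [x|x y|y x z].
- by apply/frac_eqP; exists 1; rewrite ?rpred1.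
- by apply/frac_eqP/frac_eqP => -[u uS e]; exists u.
move=> /frac_eqP[u uS e] /frac_eqP[v vS e']; apply/frac_eqP.
exists (u * v * sval y.2); first by rewrite !rpredM ?(svalP y.2).
transitivity (v * sval z.2 * (u * (x.1 * sval y.2))); first by ring.
by rewrite e; transitivity (u * sval x.2 * (v * (y.1 * sval z.2)));
  [ring | rewrite e'; ring].
Qed.

Canonical frac_equiv := EquivRelPack frac_eq_equiv.

Definition loc : Type := {eq_quot frac_equiv}.

HB.instance Definition _ := Choice.on loc.

Definition loc_pi (x : frac) : loc := \pi_({eq_quot frac_equiv}) x.

Lemma loc_pi_surj (q : loc) : exists x, q = loc_pi x.
Proof. by exists (repr q); rewrite /loc_pi reprK. Qed.

Lemma loc_pi_eq x y :
  loc_pi x = loc_pi y <->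
  exists2 u, u \in S & u * (x.1 * sval y.2) = u * (y.1 * sval x.2).
Proof.
split=> [/eqP|exy]; first by rewrite eqmodE => /frac_eqP.
by apply/eqP; rewrite eqmodE; apply/frac_eqP.
Qed.

Lemma repr_loc_pi x :
  exists2 u, u \in S &
    u * ((repr (loc_pi x)).1 * sval x.2) = u * (x.1 * sval (repr (loc_pi x)).2).
Proof. by apply/loc_pi_eq; rewrite /loc_pi reprK. Qed.

Definition den_mul (s t : {s : R | s \in S}) : {s : R | s \in S} :=
  exist _ (sval s * sval t) (rpredM (svalP s) (svalP t)).
Definition den1 : {s : R | s \in S} := exist _ 1 (rpred1 S).

Definition frac_add x y : frac :=
  (x.1 * sval y.2 + y.1 * sval x.2, den_mul x.2 y.2).
Definition frac_mul x y : frac := (x.1 * y.1, den_mul x.2 y.2).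
Definition frac_opp x : frac := (- x.1, x.2).

Definition loc_add (p q : loc) : loc := loc_pi (frac_add (repr p) (repr q)).
Definition loc_mul (p q : loc) : loc := loc_pi (frac_mul (repr p) (repr q)).
Definition loc_opp (p : loc) : loc := loc_pi (frac_opp (repr p)).

Lemma loc_addE x y : loc_add (loc_pi x) (loc_pi y) = loc_pi (frac_add x y).
Proof.
apply/loc_pi_eq; have [u uS e] := repr_loc_pi x; have [v vS f] := repr_loc_pi y.
exists (u * v); first by rewrite rpredM.
rewrite /=; move: (repr _) (repr _) e f => b a e f.
transitivity (v * sval y.2 * sval b.2 * (u * (a.1 * sval x.2)) +
              u * sval x.2 * sval a.2 * (v * (b.1 * sval y.2))); first by ring.
by rewrite e f; ring.
Qed.

Lemma loc_mulE x y : loc_mul (loc_pi x) (loc_pi y) = loc_pi (frac_mul x y).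
Proof.
apply/loc_pi_eq; have [u uS e] := repr_loc_pi x; have [v vS f] := repr_loc_pi y.
exists (u * v); first by rewrite rpredM.
rewrite /=; move: (repr _) (repr _) e f => b a e f.
transitivity ((u * (a.1 * sval x.2)) * (v * (b.1 * sval y.2))); first by ring.
by rewrite e f; ring.
Qed.

Lemma loc_oppE x : loc_opp (loc_pi x) = loc_pi (frac_opp x).
Proof.
apply/loc_pi_eq; have [u uS e] := repr_loc_pi x; exists u => //=.
by rewrite !mulNr !mulrN e.
Qed.

Lemma loc_eqI x y : x.1 * sval y.2 = y.1 * sval x.2 -> loc_pi x = loc_pi y.
Proof. by move=> e; apply/loc_pi_eq; exists 1; rewrite ?rpred1 ?e. Qed.

Fact loc_addA : associative loc_add.
Proof.
move=> p q r; have [x ->] := loc_pi_surj p; have [y ->] := loc_pi_surj q.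
have [z ->] := loc_pi_surj r; rewrite (loc_addE y) (loc_addE x) (loc_addE x y).
by rewrite loc_addE; apply: loc_eqI => /=; ring.
Qed.

Fact loc_addC : commutative loc_add.
Proof.
move=> p q; have [x ->] := loc_pi_surj p; have [y ->] := loc_pi_surj q.
by rewrite (loc_addE x) (loc_addE y); apply: loc_eqI => /=; ring.
Qed.

Fact loc_add0 : left_id (loc_pi (0, den1)) loc_add.
Proof.
move=> p; have [x ->] := loc_pi_surj p.
by rewrite loc_addE; apply: loc_eqI => /=; ring.
Qed.

Fact loc_addN : left_inverse (loc_pi (0, den1)) loc_opp loc_add.
Proof.
move=> p; have [x ->] := loc_pi_surj p.
by rewrite loc_oppE loc_addE; apply: loc_eqI => /=; ring.
Qed.

HB.instance Definition _ :=
  GRing.isZmodule.Build loc loc_addA loc_addC loc_add0 loc_addN.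

Fact loc_mulA : associative loc_mul.
Proof.
move=> p q r; have [x ->] := loc_pi_surj p; have [y ->] := loc_pi_surj q.
have [z ->] := loc_pi_surj r; rewrite (loc_mulE y) (loc_mulE x) (loc_mulE x y).
by rewrite loc_mulE; apply: loc_eqI => /=; ring.
Qed.

Fact loc_mulC : commutative loc_mul.
Proof.
move=> p q; have [x ->] := loc_pi_surj p; have [y ->] := loc_pi_surj q.
by rewrite (loc_mulE x) (loc_mulE y); apply: loc_eqI => /=; ring.
Qed.

Fact loc_mul1 : left_id (loc_pi (1, den1)) loc_mul.
Proof.
move=> p; have [x ->] := loc_pi_surj p.
by rewrite loc_mulE; apply: loc_eqI => /=; ring.
Qed.

Fact loc_mulDl : left_distributive loc_mul +%R.
Proof.
move=> p q r; have [x ->] := loc_pi_surj p; have [y ->] := loc_pi_surj q.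
have [z ->] := loc_pi_surj r.
change (loc_mul (loc_add (loc_pi x) (loc_pi y)) (loc_pi z) =
  loc_add (loc_mul (loc_pi x) (loc_pi z)) (loc_mul (loc_pi y) (loc_pi z))).
rewrite (loc_addE x) (loc_mulE x) (loc_mulE y) loc_mulE loc_addE.
by apply: loc_eqI => /=; ring.
Qed.

HB.instance Definition _ := GRing.Zmodule_isComPzRing.Build loc
  loc_mulA loc_mulC loc_mul1 loc_mulDl.

Definition loc_of (r : R) : loc := loc_pi (r, den1).

Fact loc_of_is_zmod_morphism : zmod_morphism loc_of.
Proof.
move=> r t.
change (loc_of (r - t) = loc_add (loc_of r) (loc_opp (loc_of t))).
by rewrite loc_oppE loc_addE; apply: loc_eqI => /=; ring.
Qed.

Fact loc_of_is_monoid_morphism : monoid_morphism loc_of.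
Proof.
split=> // r t; change (loc_of (r * t) = loc_mul (loc_of r) (loc_of t)).
by rewrite loc_mulE; apply: loc_eqI => /=; ring.
Qed.

HB.instance Definition _ :=
  GRing.isZmodMorphism.Build R loc loc_of loc_of_is_zmod_morphism.
HB.instance Definition _ :=
  GRing.isMonoidMorphism.Build R loc loc_of loc_of_is_monoid_morphism.

Lemma loc_of_eq0 r : loc_of r = 0 <-> exists2 s, s \in S & s * r = 0.
Proof.
split=> [/loc_pi_eq[u uS /=]|[u uS e]].
  by rewrite mulr1 mul0r mulr0; exists u.
by apply/loc_pi_eq; exists u; rewrite //= mulr1 mul0r mulr0.
Qed.

Lemma loc_pi_den x : loc_of (sval x.2) * loc_pi x = loc_of x.1.
Proof.
rewrite [LHS]loc_mulE; apply: loc_eqI => /=; ring.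
Qed.

Lemma loc_of_unit s : s \in S -> exists p, loc_of s * p = 1.
Proof.
move=> sS; exists (loc_pi (1, exist _ s sS)).
exact: (loc_pi_den (1, exist _ s sS)).
Qed.

Section Endo.
Context (sigma : {rmorphism R -> R}).
Context (sigmaS : forall s, s \in S -> sigma s \in S).

Definition frac_endo x : frac :=
  (sigma x.1, exist _ (sigma (sval x.2)) (sigmaS (svalP x.2))).

Definition loc_endo_fun (p : loc) : loc := loc_pi (frac_endo (repr p)).

Lemma loc_endoE x : loc_endo_fun (loc_pi x) = loc_pi (frac_endo x).
Proof.
apply/loc_pi_eq; have [u uS e] := repr_loc_pi x.
by exists (sigma u); rewrite ?sigmaS //= -!rmorphM e.
Qed.

Fact loc_endo_is_zmod_morphism : zmod_morphism loc_endo_fun.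
Proof.
move=> p q; have [x ->] := loc_pi_surj p; have [y ->] := loc_pi_surj q.
change (loc_endo_fun (loc_add (loc_pi x) (loc_opp (loc_pi y))) =
  loc_add (loc_endo_fun (loc_pi x)) (loc_opp (loc_endo_fun (loc_pi y)))).
rewrite loc_oppE loc_addE !loc_endoE loc_oppE loc_addE; congr loc_pi.
congr pair; first by rewrite /= rmorphD !rmorphM rmorphN.
by apply: val_inj; rewrite /= rmorphM.
Qed.

Fact loc_endo_is_monoid_morphism : monoid_morphism loc_endo_fun.
Proof.
split=> [|p q].
  by rewrite [LHS]loc_endoE; apply: loc_eqI; rewrite /= !rmorph1.
have [x ->] := loc_pi_surj p; have [y ->] := loc_pi_surj q.
rewrite [_ * _]loc_mulE !loc_endoE [RHS]loc_mulE.
by apply: loc_eqI; rewrite /= !rmorphM.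
Qed.

Definition loc_endo : {rmorphism loc -> loc} :=
  HB.pack loc_endo_fun
    (GRing.isZmodMorphism.Build _ _ loc_endo_fun loc_endo_is_zmod_morphism)
    (GRing.isMonoidMorphism.Build _ _ loc_endo_fun loc_endo_is_monoid_morphism).

Lemma loc_endo_of r : loc_of (sigma r) = loc_endo (loc_of r).
Proof. by rewrite [RHS]loc_endoE; apply: loc_eqI; rewrite /= rmorph1. Qed.

End Endo.

End Localization.

(* theta : A -> B exhibits B as D^-1 A, for a left denominator set D of a
   possibly noncommutative ring A. *)
Definition left_ring_of_fractions (A B : pzRingType) (D : A -> Prop)
    (theta : {rmorphism A -> B}) : Prop :=
  [/\ forall d, D d -> exists b, b * theta d = 1 /\ theta d * b = 1,
      forall b, exists d a, D d /\ theta d * b = theta a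
    & forall a, theta a = 0 <-> exists d, D d /\ d * a = 0].

Section OreLocalization.
Context (R : comPzRingType) (S : mulrClosed R) (n : nat).
Context (sigma : {rmorphism R -> R}).
Context (sigmaS : forall s, s \in S -> sigma s \in S).

(* S^-1 A is realized as (S^-1 R)[x_1, ..., x_n; loc_endo sigmaS], with ore_loc
   as its canonical map from A; see ore_loc_fractions. *)
Definition ore_loc : {rmorphism ore n sigma -> ore n (loc_endo sigmaS)} :=
  ore_map n (loc_endo_of sigmaS).

Lemma ore_locC r :
  ore_loc (oreC n sigma r) = oreC n (loc_endo sigmaS) (loc_of S r).
Proof. exact: ore_mapU. Qed.

Lemma ore_loc_fractions :
  left_ring_of_fractions (fun a => exists2 s, s \in S & a = oreC n sigma s)
    ore_loc.
Proof.
split=> [_ [s sS ->]|b|f].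
- have [p sp] := loc_of_unit sS; exists (oreC n (loc_endo sigmaS) p).
  by rewrite ore_locC -!rmorphM mulrC sp rmorph1.
- elim/ore_ind: b
    => [|b b' [_ [a [[s sS ->] e]]] [_ [a' [[s' s'S ->] e']]]|c m].
  + exists 1, 0; split; last by rewrite mulr0 raddf0.
    by exists 1; rewrite ?rpred1 ?rmorph1.
  + exists (oreC n sigma (s * s')), (oreC n sigma s' * a + oreC n sigma s * a').
    split; first by exists (s * s'); rewrite ?rpredM.
    rewrite (rmorphD ore_loc) !(rmorphM ore_loc) -e -e' mulrDr !ore_locC.
    by rewrite !mulrA -!rmorphM (mulrC s').
  + have [[r s] ->] := loc_pi_surj c.
    exists (oreC n sigma (sval s)), (oreU sigma r m).
    split; first by exists (sval s); rewrite ?(svalP s).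
    by rewrite ore_locC oreCU [RHS]ore_mapU (loc_pi_den (r, s)).
- split=> [f0|[_ [[s sS ->] sf]]]; last first.
    have [p ps] := loc_of_unit sS.
    rewrite -[ore_loc f]mul1r -(rmorph1 (oreC n (loc_endo sigmaS))) -ps mulrC.
    have := congr1 ore_loc sf; rewrite rmorphM ore_locC rmorph0 => e.
    by rewrite rmorphM -mulrA e mulr0.
  have fS a : exists2 s, s \in S & s * f@_a = 0.
    apply/loc_of_eq0; have := congr1 (mcoeff a) f0.
    by rewrite [(ore_loc f)@_a]ore_map_coeff mcoeff0.
  pose s a := s2val (cid2 (fS a)).
  have sS a : s a \in S by rewrite /s; case: (cid2 _).
  have s0 a : s a * f@_a = 0 by rewrite /s; case: (cid2 _).
  exists (oreC n sigma (\prod_(a <- msupp f) s a)); split.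
    by eexists; last reflexivity; apply: rpred_prod.
  apply/malgP => a; rewrite oreC_coeff mcoeff0.
  case: (msuppP f a) => [af|_]; last by rewrite mulr0.
  by rewrite (big_fsetD1 a) //= mulrAC s0 mul0r.
Qed.

End OreLocalization.

Definition ideal (R : comPzRingType) (I : {pred R}) : Prop :=
  0 \in I /\ forall a, {in I &, forall u v, a * u + v \in I}.

Definition maximal_ideal (R : comPzRingType) (m : {pred R}) : Prop :=
  [/\ ideal m, 1 \notin m &
      forall J : {pred R}, ideal J -> 1 \notin J -> {subset m <= J} ->
        {subset J <= m}].

Record max_spec (R : comPzRingType) := MaxSpec {
  max_pred :> {pred R};
  max_specP : maximal_ideal max_pred
}.

Section LocalizationAtMax.
Context (R : comPzRingType) (m : max_spec R).

Definition max_compl : {pred R} := [pred s | s \notin m].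

Fact max_compl_mulr_closed : mulr_closed max_compl.
Proof.
have [[m0 mI] m1 mM] := max_specP m.
have mMl a u : u \in m -> a * u \in m by move=> um; rewrite -[_ * _]addr0 mI.
split=> [//|s t]; rewrite !inE => sm tm; apply/negP => stm.
pose J : {pred R} := fun x => `[< exists r i, i \in m /\ x = r * s + i >].
have JP x : reflect (exists r i, i \in m /\ x = r * s + i) (x \in J).
  exact: asboolP.
have Jid : ideal J.
  split; first by apply/JP; exists 0, 0; rewrite mul0r addr0.
  move=> a _ _ /JP[r [i [im ->]]] /JP[r' [i' [i'm ->]]]; apply/JP.
  by exists (a * r + r'), (a * i + i'); rewrite mI //; split=> //; ring.
have mJ : {subset m <= J}.
  by move=> i im; apply/JP; exists 0, i; rewrite mul0r add0r.
have sJ : s \in J by apply/JP; exists 1, 0; rewrite mul1r addr0.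
have [/JP[r [i [im e]]]|J1] := boolP (1 \in J).
  case/negP: tm; have -> : t = r * (s * t) + t * i.
    by rewrite -[LHS]mul1r e; ring.
  by rewrite mI // mMl.
by case/negP: sm; apply: mM sJ.
Qed.

HB.instance Definition _ :=
  GRing.isMulClosed.Build R max_compl max_compl_mulr_closed.

Definition loc_max : comPzRingType := loc max_compl.

Context (n : nat) (sigma : {rmorphism R -> R}).
Context (sigmaP : forall s, s \notin m -> sigma s \notin m).

Definition endo_max : {rmorphism loc_max -> loc_max} :=
  loc_endo (S := max_compl) sigmaP.

Definition ore_max : {rmorphism ore n sigma -> ore n endo_max} :=
  ore_loc (S := max_compl) n sigmaP.

End LocalizationAtMax.

(* Main.v *)
(* Quillen's patching, rewritten so that no modules are glued. For c in R let
   phi_c be the endomorphism x_i |-> c x_i of A, and let K be a presentation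
   matrix of M. The s in R such that phi_(c+sr)(K) and phi_c(K) present
   isomorphic modules for all c and r form an ideal I, and it suffices to show
   1 \in I: then K = phi_1(K) and phi_0(K), which has entries in R, present
   isomorphic modules. So one needs, for each maximal m, some s \notin m in I.

   An extended M_m yields a homotopy equivalence over A_m between K and a matrix
   over R_m, which every phi_c fixes. Comparing its images under phi_(y+z) and
   phi_y, for formal parameters y and z, gives an equivalence between these two
   twists of K that is the identity at z = 0. It differs from the identity by
   finitely many coefficients, each divisible by some sigma^i(z), so replacing z
   by sz, with sigma^i(s) divisible by the denominators for all small i, makes
   it integral; such an s \notin m exists because sigma^-1 preserves the
   complement of m. *)

Require Import Defs.
From HB Require Import structures.
From mathcomp Require Import all_boot all_algebra finmap.
From mathcomp Require Import ring.
From mathcomp Require Import boolp classical_sets.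
From mathcomp Require Import monalg.

Set Implicit Arguments.
Unset Strict Implicit.
Unset Printing Implicit Defensive.

Import GRing.Theory.

Local Open Scope ring_scope.
Local Open Scope quotient_scope.

(** * Homotopy equivalence of presentation matrices *)

Section MatrixEquivalence.
Context (T : pzRingType).

(** Here [(P, B)] and [(P', B')] are morphisms of two-term complexes of free modules, mutually
    inverse on generators up to the homotopies [Q] and [Q']. This is the matrix form of an
    isomorphism of cokernels; see [presented_equiv]. *)
Definition mx_equiv p q p' q' (K : 'M[T]_(p, q)) (L : 'M[T]_(p', q')) : Prop :=
  exists P B P' B' Q Q',
    [/\ K *m P = B *m L, L *m P' = B' *m K,
        P *m P' = 1%:M + Q *m K & P' *m P = 1%:M + Q' *m L].

Lemma mx_equiv_refl p q (K : 'M[T]_(p, q)) : mx_equiv K K.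
Proof.
exists 1%:M, 1%:M, 1%:M, 1%:M, 0, 0.
by rewrite mulmx1 !mul1mx mul0mx addr0.
Qed.

Lemma mx_equiv_trans p q p' q' p'' q'' (K : 'M[T]_(p, q)) (L : 'M[T]_(p', q'))
    (J : 'M[T]_(p'', q'')) :
  mx_equiv K L -> mx_equiv L J -> mx_equiv K J.
Proof.
case=> P [B [P' [B' [Q [Q' [KP LP' PP' P'P]]]]]].
case=> V [C [V' [C' [W [W' [LV JV' VV' V'V]]]]]].
exists (P *m V), (B *m C), (V' *m P'), (C' *m B').
(* Expanding [P V V' P'] leaves the extra term [P W L P'], and [L P' = B' K] brings [K] to the right
   end. The other homotopy is symmetric. *)
exists (Q + P *m W *m B'), (W' + V' *m Q' *m C); split.
- by rewrite mulmxA KP -mulmxA LV mulmxA.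
- by rewrite mulmxA JV' -mulmxA LP' mulmxA.
- rewrite mulmxA -(mulmxA P) VV' mulmxDr mulmx1 mulmxDl PP' mulmxDl addrA.
  by rewrite -!mulmxA LP'.
- rewrite mulmxA -(mulmxA V') P'P mulmxDr mulmx1 mulmxDl V'V mulmxDl addrA.
  by rewrite -!mulmxA LV.
Qed.

End MatrixEquivalence.

Lemma map_mx_equiv (T T' : pzRingType) (f : {rmorphism T -> T'}) p q p' q'
    (K : 'M[T]_(p, q)) (L : 'M[T]_(p', q')) :
  mx_equiv K L -> mx_equiv (map_mx f K) (map_mx f L).
Proof.
case=> P [B [P' [B' [Q [Q' [h1 h2 h3 h4]]]]]].
exists (map_mx f P), (map_mx f B), (map_mx f P'), (map_mx f B').
exists (map_mx f Q), (map_mx f Q').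
by split; rewrite -!map_mxM ?h1 ?h2 ?h3 ?h4 // map_mxD map_mxM map_mx1.
Qed.

(** * Presented modules and lifting of their maps to matrices *)

Section Presented.
Context (T : pzRingType).

Definition presented p q (K : 'M[T]_(p, q)) (M : lmodType T) : Prop :=
  exists f : {linear 'rV[T]_q -> M},
    (forall m, exists v, f v = m) /\
    (forall v, f v = 0 <-> exists u : 'rV[T]_p, v = u *m K).

Lemma linear_bij_inv (M N : lmodType T) (f : {linear M -> N}) :
  bijective f -> exists g : {linear N -> M}, cancel f g /\ cancel g f.
Proof.
case=> g fK gK.
have gB : zmod_morphism g.
  by move=> x y; apply: (can_inj fK); rewrite linearB !gK.
have gZ : scalable g by move=> a x; apply: (can_inj fK); rewrite linearZ !gK.
pose gaM := GRing.isZmodMorphism.Build N M g gB.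
pose gsM := GRing.isScalable.Build T N M *:%R g gZ.
by exists (HB.pack g gaM gsM : {linear N -> M}).
Qed.

Lemma module_iso_sym (M N : lmodType T) : module_iso M N -> module_iso N M.
Proof.
by case=> f /linear_bij_inv[g [fK gK]]; exists g; apply: (Bijective gK fK).
Qed.

Lemma module_iso_trans (M N P : lmodType T) :
  module_iso M N -> module_iso N P -> module_iso M P.
Proof.
by case=> f fb [g gb]; exists (g \o f : {linear M -> P}); apply: bij_comp.
Qed.

Lemma presented_iso p q (K : 'M[T]_(p, q)) (M N : lmodType T) :
  module_iso M N -> presented K M -> presented K N.
Proof.
case=> g gb [f [fsurj fker]]; have [h [gK hK]] := linear_bij_inv gb.
exists (g \o f : {linear 'rV[T]_q -> N}); split=> [n|v] /=.
  by have [v fv] := fsurj (h n); exists v; rewrite fv hK.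
rewrite -fker; split=> [gf0|->]; last by rewrite raddf0.
by rewrite -(gK (f v)) gf0 raddf0.
Qed.

End Presented.

(** The factor sends [m] to [h] of a chosen preimage; the inclusion of kernels makes the choice
    irrelevant, and this gives linearity. *)
Lemma linear_factor (T : pzRingType) (V M N : lmodType T)
    (f : {linear V -> M}) (h : {linear V -> N}) :
  (forall m, exists v, f v = m) -> (forall v, f v = 0 -> h v = 0) ->
  exists g : {linear M -> N}, forall v, g (f v) = h v.
Proof.
move=> fsurj fh; pose s m := sval (cid (fsurj m)).
have sK m : f (s m) = m by rewrite /s; case: cid.
have hE v w : f v = f w -> h v = h w.
  by move=> e; apply/subr0_eq; rewrite -linearB fh // linearB e subrr.
pose g m := h (s m).
have gB : zmod_morphism g.
  by move=> x y; rewrite /g -linearB; apply: hE; rewrite linearB !sK.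
have gZ : scalable g.
  by move=> a x; rewrite /g -linearZ; apply: hE; rewrite linearZ !sK.
pose gaM := GRing.isZmodMorphism.Build M N g gB.
pose gsM := GRing.isScalable.Build T M N *:%R g gZ.
by exists (HB.pack g gaM gsM : {linear M -> N}) => v; apply: hE; rewrite sK.
Qed.

Section PresentedTheory.
Context (T : pzRingType).

Lemma row_linearE r (M : lmodType T) (h : {linear 'rV[T]_r -> M}) v :
  h v = \sum_i v 0 i *: h (delta_mx 0 i).
Proof.
rewrite {1}[v]row_sum_delta linear_sum; apply: eq_bigr => i _.
by rewrite linearZ.
Qed.

Lemma linear_row_ext r (M : lmodType T) (h h' : {linear 'rV[T]_r -> M}) :
  (forall i, h (delta_mx 0 i) = h' (delta_mx 0 i)) -> h =1 h'.
Proof.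
by move=> e v; rewrite !row_linearE; apply: eq_bigr => i _; rewrite e.
Qed.

(** Projectivity of a free module: it suffices to lift the images of the basis rows. *)
Lemma mx_lift q r (M : lmodType T) (f : {linear 'rV[T]_q -> M})
    (h : {linear 'rV[T]_r -> M}) :
  (forall m, exists v, f v = m) -> exists P, forall v, h v = f (v *m P).
Proof.
move=> fsurj; pose s m := sval (cid (fsurj m)).
have sK m : f (s m) = m by rewrite /s; case: cid.
exists (\matrix_i s (h (delta_mx 0 i))) => v; apply: etrans (row_linearE h v) _.
rewrite mulmx_sum_row linear_sum; apply: eq_bigr => i _.
by rewrite rowK linearZ sK.
Qed.

Lemma mx_factor p q r (K : 'M[T]_(p, q)) (M : lmodType T)
    (f : {linear 'rV[T]_q -> M}) (P : 'M[T]_(r, q)) :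
  (forall v, f v = 0 <-> exists u : 'rV[T]_p, v = u *m K) ->
  (forall i, f (row i P) = 0) -> exists Q, P = Q *m K.
Proof.
move=> fker fP; have uP i := (fker (row i P)).1 (fP i).
exists (\matrix_i sval (cid (uP i))); apply/row_matrixP => i.
by rewrite row_mul rowK; case: cid.
Qed.

(** An isomorphism and its inverse lift to [P] and [P']. The rows of [K P], [L P'], [P P' - 1] and
    [P' P - 1] then lie in kernels of the presentations, hence factor through [K] or [L]. Conversely
    [P] and [P'] descend to the quotients, where the homotopy terms vanish. *)
Lemma presented_equiv p q p' q' (K : 'M[T]_(p, q)) (L : 'M[T]_(p', q'))
    (M N : lmodType T) :
  presented K M -> presented L N -> module_iso M N <-> mx_equiv K L.
Proof.
case=> f [fsurj fker] [g [gsurj gker]].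
have fK u : f (u *m K) = 0 by apply/fker; exists u.
have gL u : g (u *m L) = 0 by apply/gker; exists u.
split=> [[i ib]|[P [B [P' [B' [Q [Q' [KP LP' PP' P'P]]]]]]]].
  have [j [iK jK]] := linear_bij_inv ib.
  have [P fP] := mx_lift (i \o f : {linear 'rV[T]_q -> N}) gsurj.
  have [P' gP'] := mx_lift (j \o g : {linear 'rV[T]_q' -> M}) fsurj.
  rewrite /= in fP gP'.
  have [|B KP] := mx_factor (P := K *m P) gker.
    by move=> k; rewrite row_mul -fP rowE fK raddf0.
  have [|B' LP'] := mx_factor (P := L *m P') fker.
    by move=> k; rewrite row_mul -gP' rowE gL raddf0.
  have [|Q PP'] := mx_factor (P := P *m P' - 1%:M) fker.
    move=> k; rewrite linearB linearB /= row_mul -gP' [row k P]rowE -fP iK.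
    by rewrite row1 subrr.
  have [|Q' P'P] := mx_factor (P := P' *m P - 1%:M) gker.
    move=> k; rewrite linearB linearB /= row_mul -fP [row k P']rowE -gP' jK.
    by rewrite row1 subrr.
  by exists P, B, P', B', Q, Q'; split; rewrite // -?PP' -?P'P addrC subrK.
have [|i iE] :=
    linear_factor (h := g \o mulmxr P : {linear 'rV[T]_q -> N}) fsurj.
  by move=> v /fker[u ->] /=; rewrite -mulmxA KP mulmxA gL.
have [|j jE] :=
    linear_factor (h := f \o mulmxr P' : {linear 'rV[T]_q' -> M}) gsurj.
  by move=> v /gker[u ->] /=; rewrite -mulmxA LP' mulmxA fK.
exists i; exists j => [m|n].
  have [v <-] := fsurj m; rewrite iE jE /= -mulmxA PP' mulmxDr mulmx1 mulmxA.
  by rewrite linearD fK addr0.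
have [v <-] := gsurj n; rewrite jE iE /= -mulmxA P'P mulmxDr mulmx1 mulmxA.
by rewrite linearD gL addr0.
Qed.

End PresentedTheory.

(** * The cokernel of a matrix as a module *)

Section Cokernel.
Context (T : pzRingType) (p q : nat) (K : 'M[T]_(p, q)).

Definition row_space : pred 'rV[T]_q := fun v => `[< exists u, v = u *m K >].

Fact row_space_zmod_closed : zmod_closed row_space.
Proof.
split=> [|_ _ /asboolP[u ->] /asboolP[v ->]]; apply/asboolP.
  by exists 0; rewrite mul0mx.
by exists (u - v); rewrite mulmxBl.
Qed.

HB.instance Definition _ :=
  GRing.isZmodClosed.Build 'rV[T]_q row_space row_space_zmod_closed.

Definition coker : Type :=
  Quotient.quot (GRing.ZmodClosed.clone 'rV[T]_q row_space _).

HB.instance Definition _ := GRing.Zmodule.on coker.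

Definition coker_pi (v : 'rV[T]_q) : coker := \pi v.

Fact coker_pi_is_zmod_morphism : zmod_morphism coker_pi.
Proof. by move=> x y; rewrite /coker_pi raddfB. Qed.

HB.instance Definition _ :=
  GRing.isZmodMorphism.Build 'rV[T]_q coker coker_pi coker_pi_is_zmod_morphism.

Lemma coker_pi_eq0 v : coker_pi v = 0 <-> exists u : 'rV[T]_p, v = u *m K.
Proof.
rewrite -(raddf0 coker_pi); split=> [/eqP|uK]; first rewrite -Quotient.idealrBE.
  by rewrite subr0 => /asboolP.
by apply/eqP; rewrite -Quotient.idealrBE subr0; apply/asboolP.
Qed.

Lemma coker_pi_surj x : exists v, coker_pi v = x.
Proof. by exists (repr x); rewrite /coker_pi reprK. Qed.

Definition coker_scale (a : T) (x : coker) : coker := coker_pi (a *: repr x).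

Lemma coker_scaleE a v : coker_scale a (coker_pi v) = coker_pi (a *: v).
Proof.
apply/subr0_eq; rewrite -raddfB -scalerBr; apply/coker_pi_eq0.
have /coker_pi_eq0[u ->] : coker_pi (repr (coker_pi v) - v) = 0.
  by rewrite raddfB /= {1}/coker_pi reprK subrr.
by exists (a *: u); rewrite scalemxAl.
Qed.

Fact coker_scaleA a b x :
  coker_scale a (coker_scale b x) = coker_scale (a * b) x.
Proof.
by have [v <-] := coker_pi_surj x; rewrite !coker_scaleE scalerA.
Qed.

Fact coker_scale1 : left_id 1 coker_scale.
Proof.
by move=> x; have [v <-] := coker_pi_surj x; rewrite coker_scaleE scale1r.
Qed.

Fact coker_scaleDr : right_distributive coker_scale +%R.
Proof.
move=> a x y; have [v <-] := coker_pi_surj x; have [w <-] := coker_pi_surj y.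
by rewrite -raddfD !coker_scaleE scalerDr raddfD.
Qed.

Fact coker_scaleDl x : {morph coker_scale^~ x : a b / a + b}.
Proof.
move=> a b; have [v <-] := coker_pi_surj x.
by rewrite !coker_scaleE scalerDl raddfD.
Qed.

HB.instance Definition _ := GRing.Zmodule_isLmodule.Build T coker
  coker_scaleA coker_scale1 coker_scaleDr coker_scaleDl.

Fact coker_pi_is_scalable : scalable coker_pi.
Proof. by move=> a v; rewrite -coker_scaleE. Qed.

HB.instance Definition _ :=
  GRing.isScalable.Build T 'rV[T]_q coker *:%R coker_pi coker_pi_is_scalable.

Lemma presented_coker : presented K coker.
Proof.
by exists coker_pi; split; [exact: coker_pi_surj | exact: coker_pi_eq0].
Qed.

End Cokernel.

(** * Extension of scalars: functoriality, presentations, transitivity *)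

Section TensorTheory.
Context (S T : pzRingType) (phi : {rmorphism S -> T}).

Lemma tensor_ext (M : lmodType S) (N : lmodType T)
    (g h : {linear tensor phi M -> N}) :
  (forall m, g (pure phi 1 m) = h (pure phi 1 m)) -> g =1 h.
Proof.
move=> e x; elim/(@tensor_ind S T phi M): x => [|x y IHx IHy|t m].
  by rewrite !raddf0.
  by rewrite !raddfB /= IHx IHy.
by rewrite -[t]mulr1 -pureZ !linearZ e.
Qed.

Lemma pure1Z (M : lmodType S) s (m : M) :
  pure phi 1 (s *: m) = phi s *: pure phi 1 m.
Proof. by rewrite -pure_balanced mul1r pureZ mulr1. Qed.

Fact pure1_is_zmod_morphism (M : lmodType S) :
  zmod_morphism (pure phi 1 : M -> tensor phi M).
Proof.
move=> x y; apply/eqP; rewrite eq_sym subr_eq; apply/eqP.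
by rewrite -pureDr subrK.
Qed.

HB.instance Definition _ (M : lmodType S) :=
  GRing.isZmodMorphism.Build M (tensor phi M) (pure phi 1)
    (@pure1_is_zmod_morphism M).

Lemma tensor_map (M N : lmodType S) (f : {linear M -> N}) :
  exists g : {linear tensor phi M -> tensor phi N},
    forall m, g (pure phi 1 m) = pure phi 1 (f m).
Proof.
pose h : {additive M -> tensor phi N} := (pure phi 1 \o f).
have [s m|g gE] := tensor_lift (f := h) (phi := phi).
  by rewrite /= linearZ pure1Z.
by exists g => m; rewrite gE scale1r.
Qed.

Lemma tensor_iso (M N : lmodType S) :
  module_iso M N -> module_iso (tensor phi M) (tensor phi N).
Proof.
case=> f fb; have [g [fK gK]] := linear_bij_inv fb.
have [F FE] := tensor_map f; have [G GE] := tensor_map g.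
exists F; exists G.
  by apply: (tensor_ext (g := G \o F) (h := idfun)) => m /=; rewrite FE GE fK.
by apply: (tensor_ext (g := F \o G) (h := idfun)) => m /=; rewrite GE FE gK.
Qed.

(** Right exactness of the tensor product. The kernel of the extended map [G] is bounded by a map
    from the tensor product back to the cokernel of [map_mx phi K]. *)
Lemma presented_tensor p q (K : 'M[S]_(p, q)) (M : lmodType S) :
  presented K M -> presented (map_mx phi K) (tensor phi M).
Proof.
case=> f [fsurj fker].
pose F (w : 'rV[T]_q) : tensor phi M :=
  \sum_i w 0 i *: pure phi 1 (f (delta_mx 0 i)).
have FB : zmod_morphism F.
  move=> v w; rewrite /F -sumrB; apply: eq_bigr => i _.
  by rewrite !mxE scalerBl.
have FZ : scalable F.
  move=> a v; rewrite /F scaler_sumr; apply: eq_bigr => i _.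
  by rewrite mxE scalerA.
pose FaM := GRing.isZmodMorphism.Build 'rV[T]_q (tensor phi M) F FB.
pose FsM := GRing.isScalable.Build T 'rV[T]_q (tensor phi M) *:%R F FZ.
have [G GE] : exists G : {linear 'rV[T]_q -> tensor phi M},
    forall v, G (map_mx phi v) = pure phi 1 (f v).
  exists (HB.pack F FaM FsM : {linear 'rV[T]_q -> tensor phi M}) => v.
  rewrite [f v]row_linearE raddf_sum /= /F; apply: eq_bigr => i _.
  by rewrite mxE pure1Z.
pose s m := sval (cid (fsurj m)).
have sK m : f (s m) = m by rewrite /s; case: cid.
(* The class of a lift of [m] does not depend on the lift, so [h] is semilinear and extends to [g]
   on the tensor product. As [g \o G] is the projection to the cokernel, [G w = 0] puts [w] in the
   row space. *)
pose h m := coker_pi (map_mx phi K) (map_mx phi (s m)).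
have hE v w : f v = f w ->
    coker_pi (map_mx phi K) (map_mx phi v) =
    coker_pi (map_mx phi K) (map_mx phi w).
  move=> e; apply/subr0_eq; rewrite -raddfB -map_mxB; apply/coker_pi_eq0.
  have /fker[u ->] : f (v - w) = 0 by rewrite linearB e subrr.
  by exists (map_mx phi u); rewrite map_mxM.
have hB : zmod_morphism h.
  move=> x y; rewrite /h -raddfB -map_mxB; apply: hE.
  by rewrite linearB !sK.
have hZ a m : h (a *: m) = phi a *: h m.
  by rewrite /h -linearZ -map_mxZ; apply: hE; rewrite linearZ !sK.
pose haM := GRing.isZmodMorphism.Build M (coker (map_mx phi K)) h hB.
have [g gE] := tensor_lift (f := HB.pack h haM) hZ.
have gF : g \o G =1 coker_pi (map_mx phi K).
  apply: (linear_row_ext (h := g \o G) (h' := coker_pi (map_mx phi K))) => i.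
  rewrite /= -(map_delta_mx phi) GE gE scale1r.
  by apply: hE; rewrite sK.
exists G; split=> [x|w].
  elim/(@tensor_ind S T phi M): x => [|x y [v <-] [w <-]|t m].
  - by exists 0; rewrite raddf0.
  - by exists (v - w); rewrite raddfB.
  - have [v <-] := fsurj m; exists (t *: map_mx phi v).
    by rewrite linearZ GE /= pureZ mulr1.
split=> [Fw|[u ->]].
  by apply/coker_pi_eq0; rewrite -gF /= Fw raddf0.
apply: (linear_row_ext (h := G \o mulmxr (map_mx phi K)) (h' := \0)) => i /=.
rewrite -(map_delta_mx phi) -map_mxM GE.
have -> : f (delta_mx 0 i *m K) = 0 by apply/fker; exists (delta_mx 0 i).
by rewrite raddf0.
Qed.

End TensorTheory.

(** The alias lets the group of [N] carry a second scalar multiplication, so that a [T]-module can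
    be the target of a lift over [S]. *)
Definition restriction (S T : pzRingType) (psi : {rmorphism S -> T})
    (N : lmodType T) : Type := N.

Section Restriction.
Context (S T : pzRingType) (psi : {rmorphism S -> T}) (N : lmodType T).

Local Notation restriction := (restriction psi N).

HB.instance Definition _ := GRing.Zmodule.on restriction.

Definition restriction_scale (s : S) (x : restriction) : restriction :=
  psi s *: (x : N).

Fact restriction_scaleA a b x :
  restriction_scale a (restriction_scale b x) = restriction_scale (a * b) x.
Proof. by rewrite /restriction_scale scalerA rmorphM. Qed.

Fact restriction_scale1 : left_id 1 restriction_scale.
Proof. by move=> x; rewrite /restriction_scale rmorph1 scale1r. Qed.

Fact restriction_scaleDr : right_distributive restriction_scale +%R.
Proof. by move=> a x y; rewrite /restriction_scale scalerDr. Qed.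

Fact restriction_scaleDl x : {morph restriction_scale^~ x : a b / a + b}.
Proof. by move=> a b; rewrite /restriction_scale rmorphD scalerDl. Qed.

HB.instance Definition _ := GRing.Zmodule_isLmodule.Build S restriction
  restriction_scaleA restriction_scale1 restriction_scaleDr
  restriction_scaleDl.

End Restriction.

(** Two uses of the universal property give one map and a single use gives the other; they exchange
    [1 (x) (1 (x) m)] and [1 (x) m], and such tensors generate both sides. *)
Lemma tensor_comp (R S T : pzRingType) (phi : {rmorphism R -> S})
    (psi : {rmorphism S -> T}) (chi : {rmorphism R -> T}) (M : lmodType R) :
  (forall r, chi r = psi (phi r)) ->
  module_iso (tensor psi (tensor phi M)) (tensor chi M).
Proof.
move=> chiE; pose N : lmodType T := tensor chi M.
pose f : {additive M -> restriction psi N} := (pure chi 1 : M -> N).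
have [r m|h hE] := tensor_lift (f := f) (phi := phi).
  by rewrite /f /= pure1Z chiE.
have [s x|g gE] := tensor_lift (N := N)
    (f := h : {additive tensor phi M -> N}) (phi := psi).
  exact: (linearZ_LR h).
pose f' : {additive M -> tensor psi (tensor phi M)} :=
  (pure psi 1 \o pure phi 1).
have [r m|g' g'E] := tensor_lift (f := f') (phi := chi).
  by rewrite /f' /= !pure1Z chiE.
have gg' m : g (pure psi 1 (pure phi 1 m)) = pure chi 1 m.
  by rewrite gE scale1r /= hE scale1r.
have g'g m : g' (pure chi 1 m) = pure psi 1 (pure phi 1 m).
  by rewrite g'E scale1r.
exists g; exists g'; last first.
  by apply: (tensor_ext (g := g \o g') (h := idfun)) => m /=; rewrite g'g gg'.
apply: (tensor_ext (g := g' \o g) (h := idfun)) => x /=.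
elim/(@tensor_ind R S phi M): x => [|x y IHx IHy|s m].
- by rewrite (raddf0 (pure psi 1)) (raddf0 g) (raddf0 g').
- have e u v : g' (g (u - v)) = g' (g u) - g' (g v).
    by rewrite (raddfB g) (raddfB g').
  have -> : pure psi 1 (x - y) = pure psi 1 x - pure psi 1 y.
    exact: (raddfB (pure psi 1)).
  by apply: etrans (e _ _) (congr2 (fun u v => u - v) IHx IHy).
- by rewrite -[s]mulr1 -pureZ pure1Z !linearZ gg' g'g.
Qed.

Lemma tensor_id (S : pzRingType) (phi : {rmorphism S -> S}) (M : lmodType S) :
  (forall s, phi s = s) -> module_iso (tensor phi M) M.
Proof.
move=> phi1; have [s m|g gE] :=
    tensor_lift (f := idfun : {additive M -> M}) (phi := phi).
  by rewrite phi1.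
have hZ : scalable (pure phi 1 : M -> _) by move=> s m; rewrite pure1Z phi1.
exists g; exists (pure phi 1) => [x|m]; last by rewrite gE scale1r.
elim/(@tensor_ind S S phi M): x => [|x y IHx IHy|t m].
- by rewrite !raddf0.
- by rewrite !raddfB /= IHx IHy.
- by rewrite gE hZ pureZ mulr1.
Qed.

(** * Substitutions [x_i |-> c x_i] and the augmentation of an Ore extension *)

Section SkewPower.
Context (R : comPzRingType) (sigma : {rmorphism R -> R}).

(** The coefficient of [(c x_i)^k]: moving the factors [c] to the left past the variables gives
    [c sigma(c) ... sigma^(k-1)(c) x_i^k]. *)
Definition skew_exp (c : R) k : R := \prod_(i < k) iter i sigma c.

Lemma skew_expD c j k :
  skew_exp c (j + k) = skew_exp c j * iter j sigma (skew_exp c k).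
Proof.
rewrite /skew_exp big_split_ord /=; congr (_ * _).
by elim: j => [//|j IHj] /=; rewrite -IHj rmorph_prod.
Qed.

Lemma skew_exp0 k : skew_exp 0 k = (k == 0)%:R.
Proof.
case: k => [|k]; first by rewrite /skew_exp big_ord0.
by rewrite /skew_exp big_ord_recl /= mul0r.
Qed.

Lemma skew_exp1 k : skew_exp 1 k = 1.
Proof. by rewrite /skew_exp big1 // => i _; rewrite iter_sigma1. Qed.

End SkewPower.

Lemma rmorph_iter (R R' : pzRingType) (sigma : {rmorphism R -> R})
    (sigma' : {rmorphism R' -> R'}) (theta : {rmorphism R -> R'}) :
  (forall r, theta (sigma r) = sigma' (theta r)) ->
  forall k r, theta (iter k sigma r) = iter k sigma' (theta r).
Proof. by move=> e; elim=> //= k IHk r; rewrite e IHk. Qed.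

Lemma rmorph_skew_exp (R R' : comPzRingType) (sigma : {rmorphism R -> R})
    (sigma' : {rmorphism R' -> R'}) (theta : {rmorphism R -> R'}) :
  (forall r, theta (sigma r) = sigma' (theta r)) ->
  forall c k, theta (skew_exp sigma c k) = skew_exp sigma' (theta c) k.
Proof.
move=> e c k; rewrite rmorph_prod; apply: eq_bigr => i _.
exact: rmorph_iter.
Qed.

Section OreTwist.
Context (R R' : comPzRingType) (n : nat).
Context (sigma : {rmorphism R -> R}) (sigma' : {rmorphism R' -> R'}).
Context (theta : {rmorphism R -> R'}).
Context (thetaS : forall r, theta (sigma r) = sigma' (theta r)) (c : R').

(** The map that is [theta] on coefficients and sends each [x_i] to [c x_i]. The elements [c x_i]
    commute with each other, and they satisfy the skew relation because [R'] is commutative. *)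
Definition ore_twist_fun (f : ore n sigma) : ore n sigma' :=
  \sum_(a <- msupp f) oreU sigma' (theta f@_a * skew_exp sigma' c (mdeg a)) a.

Lemma ore_twist_coeff f a :
  (ore_twist_fun f)@_a = theta f@_a * skew_exp sigma' c (mdeg a).
Proof.
rewrite /ore_twist_fun raddf_sum /=; case: (msuppP f a) => [af|naf].
  rewrite (big_fsetD1 a) //= oreU_coeff eqxx big1_fset ?addr0 // => b.
  by rewrite in_fsetD1 oreU_coeff => /andP[/negbTE->].
rewrite rmorph0 mul0r big1_fset // => b bf _; rewrite oreU_coeff.
by case: eqP => // ba; rewrite ba (negbTE naf) in bf.
Qed.

Lemma ore_twistU d a :
  ore_twist_fun (oreU sigma d a) =
  oreU sigma' (theta d * skew_exp sigma' c (mdeg a)) a.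
Proof.
apply/malgP => b; rewrite ore_twist_coeff !oreU_coeff.
by case: eqP => [->|_] //; rewrite rmorph0 mul0r.
Qed.

Fact ore_twist_is_zmod_morphism : zmod_morphism ore_twist_fun.
Proof.
move=> f g; apply/malgP => a.
by rewrite mcoeffB !ore_twist_coeff mcoeffB rmorphB mulrBl.
Qed.

HB.instance Definition _ := GRing.isZmodMorphism.Build
  (ore n sigma) (ore n sigma') ore_twist_fun ore_twist_is_zmod_morphism.

Fact ore_twist_is_monoid_morphism : monoid_morphism ore_twist_fun.
Proof.
split=> [|f g].
  by rewrite [LHS]ore_twistU rmorph1 mdeg1 /skew_exp big_ord0 mulr1.
elim/ore_ind: f => [|f f' IH IH'|d a].
- by rewrite mul0r !raddf0 mul0r.
- by rewrite mulrDl !raddfD /= IH IH' mulrDl.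
elim/ore_ind: g => [|g g' IH IH'|e b].
- by rewrite mulr0 !raddf0 mulr0.
- by rewrite mulrDr !raddfD /= IH IH' mulrDr.
rewrite oreUM !ore_twistU oreUM rmorphM (rmorph_iter thetaS) mdegM skew_expD.
by rewrite iter_sigmaM; congr oreU; ring.
Qed.

Definition ore_twist : {rmorphism ore n sigma -> ore n sigma'} :=
  HB.pack ore_twist_fun
    (GRing.isZmodMorphism.Build _ _ ore_twist_fun ore_twist_is_zmod_morphism)
    (GRing.isMonoidMorphism.Build _ _ ore_twist_fun
       ore_twist_is_monoid_morphism).

Lemma ore_twistE f a :
  (ore_twist f)@_a = theta f@_a * skew_exp sigma' c (mdeg a).
Proof. exact: ore_twist_coeff. Qed.

Lemma ore_twistC d : ore_twist (oreC n sigma d) = oreC n sigma' (theta d).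
Proof.
by rewrite [LHS]ore_twistU mdeg1 /skew_exp big_ord0 mulr1.
Qed.

End OreTwist.

Lemma ore_mapE (R R' : pzRingType) n (sigma : {rmorphism R -> R})
    (sigma' : {rmorphism R' -> R'}) (theta : {rmorphism R -> R'})
    (thetaS : forall r, theta (sigma r) = sigma' (theta r)) f a :
  (ore_map n thetaS f)@_a = theta f@_a.
Proof. exact: ore_map_coeff. Qed.

Section Augmentation.
Context (R : pzRingType) (n : nat) (sigma : {rmorphism R -> R}).

Definition ore_aug_fun (f : ore n sigma) : R := f@_mone.

Fact ore_aug_is_zmod_morphism : zmod_morphism ore_aug_fun.
Proof. by move=> f g; rewrite /ore_aug_fun mcoeffB. Qed.

HB.instance Definition _ := GRing.isZmodMorphism.Build
  (ore n sigma) R ore_aug_fun ore_aug_is_zmod_morphism.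

(** A product of two monomials is constant only if both are, and then no power of [sigma] is
    applied. *)
Fact ore_aug_is_monoid_morphism : monoid_morphism ore_aug_fun.
Proof.
split=> [|f g]; first by rewrite /ore_aug_fun [LHS]oreU_coeff eqxx.
elim/ore_ind: f => [|f f' IH IH'|d a].
- by rewrite mul0r !raddf0 mul0r.
- by rewrite mulrDl !raddfD /= IH IH' mulrDl.
elim/ore_ind: g => [|g g' IH IH'|e b].
- by rewrite mulr0 !raddf0 mulr0.
- by rewrite mulrDr !raddfD /= IH IH' mulrDr.
rewrite oreUM /ore_aug_fun !oreU_coeff cmM_eq1.
case: eqP => [->|_]; last by rewrite !mulr0n mul0r.
by rewrite mdeg1 /=; case: eqP => _; rewrite ?mulr0n ?mulr0.
Qed.

Definition ore_aug : {rmorphism ore n sigma -> R} :=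
  HB.pack ore_aug_fun
    (GRing.isZmodMorphism.Build _ _ ore_aug_fun ore_aug_is_zmod_morphism)
    (GRing.isMonoidMorphism.Build _ _ ore_aug_fun ore_aug_is_monoid_morphism).

Lemma ore_augC r : ore_aug (oreC n sigma r) = r.
Proof. by rewrite [LHS]oreU_coeff eqxx. Qed.

End Augmentation.

(** * Functoriality of localization *)

Section LocalizationMap.
Context (R R' : comPzRingType) (S : mulrClosed R) (S' : mulrClosed R').
Context (theta : {rmorphism R -> R'}).
Context (thetaS : forall s, s \in S -> theta s \in S').

Definition frac_map (x : Defs.frac S) : Defs.frac S' :=
  (theta x.1, exist _ (theta (sval x.2)) (thetaS (svalP x.2))).

Definition loc_map_fun (p : loc S) : loc S' := loc_pi (frac_map (repr p)).

Lemma loc_mapE x : loc_map_fun (loc_pi x) = loc_pi (frac_map x).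
Proof.
apply/loc_pi_eq; have [u uS e] := repr_loc_pi x.
by exists (theta u); rewrite ?thetaS //= -!rmorphM e.
Qed.

Fact loc_map_is_zmod_morphism : zmod_morphism loc_map_fun.
Proof.
move=> p q; have [x ->] := loc_pi_surj p; have [y ->] := loc_pi_surj q.
change (loc_map_fun (loc_add (loc_pi x) (loc_opp (loc_pi y))) =
  loc_add (loc_map_fun (loc_pi x)) (loc_opp (loc_map_fun (loc_pi y)))).
rewrite loc_oppE loc_addE !loc_mapE loc_oppE loc_addE.
by apply: loc_eqI => /=; rewrite rmorphD !rmorphM rmorphN.
Qed.

Fact loc_map_is_monoid_morphism : monoid_morphism loc_map_fun.
Proof.
split=> [|p q].
  by rewrite [LHS]loc_mapE; apply: loc_eqI; rewrite /= !rmorph1.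
have [x ->] := loc_pi_surj p; have [y ->] := loc_pi_surj q.
rewrite [_ * _]loc_mulE !loc_mapE [RHS]loc_mulE.
by apply: loc_eqI; rewrite /= !rmorphM.
Qed.

Definition loc_map : {rmorphism loc S -> loc S'} :=
  HB.pack loc_map_fun
    (GRing.isZmodMorphism.Build _ _ loc_map_fun loc_map_is_zmod_morphism)
    (GRing.isMonoidMorphism.Build _ _ loc_map_fun loc_map_is_monoid_morphism).

Lemma loc_map_of r : loc_map (loc_of S r) = loc_of S' (theta r).
Proof. by rewrite [LHS]loc_mapE; apply: loc_eqI; rewrite /= rmorph1. Qed.

Lemma loc_map_endo (sigma : {rmorphism R -> R}) (sigma' : {rmorphism R' -> R'})
    (sigmaS : forall s, s \in S -> sigma s \in S)
    (sigmaS' : forall s, s \in S' -> sigma' s \in S') :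
  (forall r, theta (sigma r) = sigma' (theta r)) ->
  forall p, loc_map (loc_endo sigmaS p) = loc_endo sigmaS' (loc_map p).
Proof.
move=> e p; have [x ->] := loc_pi_surj p.
rewrite /= loc_endoE !loc_mapE loc_endoE.
by apply: loc_eqI; rewrite /= !e.
Qed.

End LocalizationMap.

Lemma rmap_mxB (T T' : pzRingType) (f : {rmorphism T -> T'}) p q
    (A B : 'M[T]_(p, q)) :
  map_mx f (A - B) = map_mx f A - map_mx f B.
Proof. by apply/matrixP => i j; rewrite !mxE rmorphB. Qed.

(** * Two specializations of a homotopy equivalence, compared modulo [eps] *)

Section SplitHomotopy.
Context (T0 T : pzRingType) (phi1 phi2 : {rmorphism T0 -> T}).
Context (eps : {rmorphism T -> T}).
Context (eps12 : forall x, eps (phi1 x) = eps (phi2 x)).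
Context (p q p' q' : nat) (K : 'M[T0]_(p, q)) (L : 'M[T0]_(p', q')).
Context (U : 'M[T0]_(q, q')) (X : 'M[T0]_(p, p')).
Context (V : 'M[T0]_(q', q)) (Y : 'M[T0]_(p', p)).
Context (Z : 'M[T0]_(q, p)) (W : 'M[T0]_(q', p')).
Context (KU : K *m U = X *m L) (LV : L *m V = Y *m K).
Context (UV : U *m V = 1%:M + Z *m K) (VU : V *m U = 1%:M + W *m L).
Context (L12 : map_mx phi1 L = map_mx phi2 L).

Local Notation "M '^1'" := (map_mx phi1 M) (at level 2, format "M '^1'").
Local Notation "M '^2'" := (map_mx phi2 M) (at level 2, format "M '^2'").
Local Notation "M '^e'" := (map_mx eps M) (at level 2, format "M '^e'").

(** The failure of [Z] to be a homotopy on relations: [X Y] and [1 + K Z] agree only after right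
    multiplication by [K]. *)
Definition htpy_corr1 := X *m Y - K *m Z - 1%:M.
(** Both terms become [U V U V - U V] after right multiplication by [K]; the difference is
    subtracted in [htpyQ] to make that matrix vanish under [eps]. *)
Definition htpy_corr2 := U *m W *m Y - U *m V *m Z.

Lemma htpy_corr1K : htpy_corr1 *m K = 0.
Proof.
rewrite !mulmxBl mul1mx -!mulmxA -LV [X *m _]mulmxA -KU -mulmxA UV.
rewrite mulmxDr mulmx1.
by rewrite mulmxA addrK subrr.
Qed.

Lemma htpy_corr2K : htpy_corr2 *m K = 0.
Proof.
have ZK : Z *m K = U *m V - 1%:M by rewrite UV addrC addKr.
have WL : W *m L = V *m U - 1%:M by rewrite VU addrC addKr.
rewrite mulmxBl -!mulmxA ZK -LV (mulmxA W) WL mulmxBl mul1mx !mulmxBr !mulmx1.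
by rewrite !mulmxA subrr.
Qed.

(** The composite of [U] and [V] through [L^1 = L^2] reduces to [U V = 1 + Z K] under [eps];
    subtracting a null-homotopic term makes the reduction the identity. *)
Definition htpyP := U^1 *m V^2 - Z^2 *m K^2.
(** The first two terms are forced by [htpyP]. The last one normalizes the reduction to the identity
    and does not affect [htpyPC], since it is killed by [K^2]. *)
Definition htpyC := X^1 *m Y^2 - K^1 *m Z^2 - htpy_corr1^2.

Lemma htpyPC : K^1 *m htpyP = htpyC *m K^2.
Proof.
rewrite /htpyP /htpyC !mulmxBl -[htpy_corr1^2 *m _]map_mxM htpy_corr1K.
rewrite map_mx0 subr0.
rewrite mulmxBr !mulmxA -map_mxM KU map_mxM L12; congr (_ - _).
by rewrite -!mulmxA -!map_mxM LV.
Qed.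

Lemma eps_map2 a b (J : 'M[T0]_(a, b)) : (J^2)^e = (J^1)^e.
Proof. by apply/matrixP => i j; rewrite !mxE eps12. Qed.

Lemma eps_htpyP : htpyP^e = 1%:M.
Proof.
rewrite /htpyP rmap_mxB !map_mxM !eps_map2 -!map_mxM UV !map_mxD.
by rewrite addrK !map_mx1.
Qed.

Lemma eps_htpyC : htpyC^e = 1%:M.
Proof.
rewrite /htpyC !rmap_mxB !map_mxM !eps_map2 !map_mx1.
by rewrite opprB addrC subrK.
Qed.

End SplitHomotopy.

Section SplitHomotopyInverse.
Context (T0 T : pzRingType) (phi1 phi2 : {rmorphism T0 -> T}).
Context (eps : {rmorphism T -> T}).
Context (eps12 : forall x, eps (phi1 x) = eps (phi2 x)).
Context (p q p' q' : nat) (K : 'M[T0]_(p, q)) (L : 'M[T0]_(p', q')).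
Context (U : 'M[T0]_(q, q')) (X : 'M[T0]_(p, p')).
Context (V : 'M[T0]_(q', q)) (Y : 'M[T0]_(p', p)).
Context (Z : 'M[T0]_(q, p)) (W : 'M[T0]_(q', p')).
Context (KU : K *m U = X *m L) (LV : L *m V = Y *m K).
Context (UV : U *m V = 1%:M + Z *m K) (VU : V *m U = 1%:M + W *m L).
Context (L12 : map_mx phi1 L = map_mx phi2 L).

Local Notation "M '^1'" := (map_mx phi1 M) (at level 2, format "M '^1'").
Local Notation "M '^2'" := (map_mx phi2 M) (at level 2, format "M '^2'").
Local Notation "M '^e'" := (map_mx eps M) (at level 2, format "M '^e'").

(** The first four terms are read off from expanding the product in [htpyPP]; they reduce to
    [htpy_corr2] under [eps], hence the last term, which [K^1] kills. *)
Definition htpyQ := Z^1 + U^1 *m W^2 *m Y^1 - U^1 *m V^2 *m Z^1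
  - Z^2 *m htpyC phi2 phi1 K X Y Z - (htpy_corr2 U V Y Z W)^1.

Lemma htpyPP :
  htpyP phi1 phi2 K U V Z *m htpyP phi2 phi1 K U V Z = 1%:M + htpyQ *m K^1.
Proof.
have PC := htpyPC KU LV UV (esym L12).
have c0 : (htpy_corr2 U V Y Z W)^1 *m K^1 = 0.
  by rewrite -map_mxM (htpy_corr2K LV UV VU) map_mx0.
have PE : htpyP phi2 phi1 K U V Z = U^2 *m V^1 - Z^1 *m K^1 by [].
rewrite /htpyQ {1}/htpyP; move: (htpy_corr2 _ _ _ _ _)^1 c0 PE PC => c c0.
move: (htpyP _ _ _ _ _ _) (htpyC _ _ _ _ _ _) => P C PE PC.
rewrite !mulmxBl c0 subr0 -!mulmxA -PC addrA; congr (_ - _).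
rewrite mulmxDl addrA {}PE !mulmxBr; congr (_ - _).
rewrite (mulmxA V^2) -[V^2 *m U^2]map_mxM VU map_mxD map_mx1 !mulmxDl !mul1mx.
rewrite mulmxDr -map_mxM UV map_mxD map_mx1 !map_mxM -!mulmxA -addrA.
do 2!congr (_ + _).
by rewrite -L12 -!map_mxM LV.
Qed.

Lemma eps_htpyQ : htpyQ^e = 0.
Proof.
have epsC : (htpyC phi2 phi1 K X Y Z)^e = 1%:M.
  by apply: eps_htpyC => x; rewrite eps12.
rewrite /htpyQ !rmap_mxB map_mxD [(Z^2 *m _)^e]map_mxM epsC mulmx1.
rewrite !map_mxM !(eps_map2 eps12) -(addrA (Z^1)^e) addrAC.
by rewrite addrK subrr.
Qed.

End SplitHomotopyInverse.

(* Equivalence of the two specializations, with every matrix involved congruent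
   modulo the kernel of eps to the corresponding one for the identity. *)
Definition split_equiv (T : pzRingType) (eps : {rmorphism T -> T}) p q
    (K K' : 'M[T]_(p, q)) : Prop :=
  exists P C P' C' Q Q',
    [/\ K *m P = C *m K', K' *m P' = C' *m K,
        P *m P' = 1%:M + Q *m K & P' *m P = 1%:M + Q' *m K'] /\
    [/\ map_mx eps P = 1%:M /\ map_mx eps P' = 1%:M,
        map_mx eps C = 1%:M /\ map_mx eps C' = 1%:M
      & map_mx eps Q = 0 /\ map_mx eps Q' = 0].

Lemma mx_equiv_split (T0 T : pzRingType) (phi1 phi2 : {rmorphism T0 -> T})
    (eps : {rmorphism T -> T}) p q p' q'
    (K : 'M[T0]_(p, q)) (L : 'M[T0]_(p', q')) :
  (forall x, eps (phi1 x) = eps (phi2 x)) ->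
  map_mx phi1 L = map_mx phi2 L -> mx_equiv K L ->
  split_equiv eps (map_mx phi1 K) (map_mx phi2 K).
Proof.
move=> eps12 L12 [U [X [V [Y [Z [W [KU LV UV VU]]]]]]].
have eps21 x : eps (phi2 x) = eps (phi1 x) by rewrite eps12.
exists (htpyP phi1 phi2 K U V Z), (htpyC phi1 phi2 K X Y Z).
exists (htpyP phi2 phi1 K U V Z), (htpyC phi2 phi1 K X Y Z).
exists (htpyQ phi1 phi2 K U X V Y Z W), (htpyQ phi2 phi1 K U X V Y Z W).
split; split.
- exact: htpyPC KU LV UV L12.
- exact: htpyPC KU LV UV (esym L12).
- exact: htpyPP KU LV UV VU L12.
- exact: htpyPP KU LV UV VU (esym L12).
- by split; apply: eps_htpyP UV.
- by split; apply: eps_htpyC.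
- by split; apply: eps_htpyQ.
Qed.

(** * Formal parameters and polynomial rings *)

(* R[y_i, z_i], i : nat, with the endomorphism extending sigma by
   y_i |-> y_(i+1), z_i |-> z_(i+1); only y = y_0 and z = z_0 are recorded.
   The substitution param_tau s maps z_i to sigma^i(s) z_i, and param_ev c r
   maps y_i to sigma^i(c), z_i to sigma^i(r). *)
Record param_ring (R : comPzRingType) (sigma : {rmorphism R -> R}) :=
    ParamRing {
  param_sort :> comPzRingType;
  param_sigma : {rmorphism param_sort -> param_sort};
  param_C : {rmorphism R -> param_sort};
  param_y : param_sort;
  param_z : param_sort;
  param_tau : R -> {rmorphism param_sort -> param_sort};
  param_ev : R -> R -> {rmorphism param_sort -> R};
  param_Csigma : forall a, param_C (sigma a) = param_sigma (param_C a);
  param_tau_sigma : forall s e,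
    param_tau s (param_sigma e) = param_sigma (param_tau s e);
  param_tauC : forall s a, param_tau s (param_C a) = param_C a;
  param_tauy : forall s, param_tau s param_y = param_y;
  param_tauz : forall s, param_tau s param_z = param_C s * param_z;
  param_tauM : forall s t e, param_tau s (param_tau t e) = param_tau (s * t) e;
  param_ev_sigma : forall c r e,
    param_ev c r (param_sigma e) = sigma (param_ev c r e);
  param_evC : forall c r a, param_ev c r (param_C a) = a;
  param_evy : forall c r, param_ev c r param_y = c;
  param_evz : forall c r, param_ev c r param_z = r;
  param_lift : forall e, param_tau 0 e = 0 -> exists N, forall t s,
    (forall i, (i < N)%N -> exists w, iter i sigma s = t * w) ->
    exists2 e', param_tau 0 e' = 0 & param_tau s e = param_C t * e';
  param_kill : forall u e, param_tau 0 e = 0 -> param_C u * e = 0 ->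
    exists N, forall s,
    (forall i, (i < N)%N -> exists w, iter i sigma s = u * w) ->
    param_tau s e = 0
}.

(** By induction on the degree, dividing by a variable that occurs. *)
Lemma cmonom_ind (I : choiceType) (P : {cmonom I} -> Prop) :
  P mone -> (forall i k, P k -> P (mmul (ucm i) k)) -> forall k, P k.
Proof.
move=> P1 PM k; move: {2}(mdeg k) (erefl (mdeg k)) => d.
elim: d k => [|d IHd] k kd; first by rewrite (mdeg_eq0I kd).
have [i ik] : exists i, k i != 0%N.
  apply: contrapT => k0; suff k1 : k = mone by rewrite k1 mdeg1 in kd.
  apply/eqP/cmP => i; rewrite cm1; apply/eqP.
  by case: eqP => // /eqP ik; case: k0; exists i.
have kE : k = mmul (ucm i) (divcm k (ucm i)).
  apply/eqP/cmP => j; rewrite cmM divcmE cmU; case: eqP => [<-|_].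
    by rewrite add1n subn1 prednK // lt0n.
  by rewrite add0n subn0.
rewrite kE; apply: PM; apply: IHd.
by move: kd; rewrite {1}kE mdegM mdegU add1n => -[].
Qed.

Section MonomialEvaluation.
Context (I : choiceType) (S : comNzRingType) (v : I -> S).
Local Notation K := {cmonom I}.

Definition cmeval (k : K) : S := \prod_(i <- finsupp k) v i ^+ k i.

Lemma cmevalEw (d : {fset I}) (k : K) :
  fsubset (finsupp k) d -> cmeval k = \prod_(i <- d) v i ^+ k i.
Proof.
move=> le; rewrite /cmeval (big_fset_incl _ le) //= => i _.
by rewrite -cmE_eq0 => /eqP ->; rewrite expr0.
Qed.

Fact cmeval_is_multiplicative : mmorphism cmeval.
Proof.
split=> [k l|]; last by rewrite /cmeval mdom1 big_seq_fset0.
rewrite (cmevalEw (fsubset_refl _)) mdomD.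
rewrite (cmevalEw (fsubsetUl _ (finsupp l))).
rewrite (cmevalEw (fsubsetUr (finsupp k) _)) -big_split /=.
by apply: eq_bigr => i _; rewrite cmM exprD.
Qed.

HB.instance Definition _ := isMultiplicative.Build K S cmeval
  cmeval_is_multiplicative.

Lemma cmevalU i : cmeval (ucm i) = v i.
Proof. by rewrite /cmeval mdomU big_seq_fset1 cmUU. Qed.

End MonomialEvaluation.

(* An interface sealing {malg R[{cmonom I}]}, whose definition would otherwise
   be unfolded by unification. *)
Record poly_ring (I : choiceType) (R : comNzRingType) := PolyRing {
  poly_sort :> comNzRingType;
  polyC : {rmorphism R -> poly_sort};
  polyX : I -> poly_sort;
  poly_coef : poly_sort -> {cmonom I} -> R;
  poly_eval_exists : forall (S : comNzRingType) (f : {rmorphism R -> S})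
    (v : I -> S), exists g : {rmorphism poly_sort -> S},
    (forall c, g (polyC c) = f c) /\ (forall i, g (polyX i) = v i);
  poly_hom_ext : forall (S : comNzRingType) (g h : {rmorphism poly_sort -> S}),
    (forall c, g (polyC c) = h (polyC c)) ->
    (forall i, g (polyX i) = h (polyX i)) -> g =1 h;
  poly_coef_ext : forall e e', poly_coef e =1 poly_coef e' -> e = e';
  poly_coefCM : forall c e k, poly_coef (polyC c * e) k = c * poly_coef e k;
  poly_coef_supp : forall e, exists r : seq {cmonom I},
    forall k, k \notin r -> poly_coef e k = 0;
  poly_coef_mul : forall e (q : {cmonom I} -> R),
    exists e', forall k, poly_coef e' k = poly_coef e k * q k;
  poly_scaleE : forall (w : I -> R) (g : {rmorphism poly_sort -> poly_sort}),
    (forall c, g (polyC c) = polyC c) ->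
    (forall i, g (polyX i) = polyC (w i) * polyX i) ->
    forall e k, poly_coef (g e) k = poly_coef e k * cmeval w k
}.

(** * The monoid algebra as a polynomial ring *)

Section MalgPolyRing.
Context (I : choiceType) (R : comNzRingType).

Local Notation K := {cmonom I}.
Local Notation P := {malg R[K]}.

Definition malg_C : {rmorphism R -> P} :=
  locked (GRing.RMorphism.clone _ _ (@malgC K R) _).

Lemma malg_CE c : malg_C c = malgC c.
Proof. by rewrite /malg_C -lock. Qed.

Definition malg_X i : P := locked << ucm i >>.

Lemma malg_eval_exists (S : comNzRingType) (f : {rmorphism R -> S})
    (v : I -> S) : exists g : {rmorphism P -> S},
  (forall c, g (malg_C c) = f c) /\ (forall i, g (malg_X i) = v i).
Proof.
exists (mmap f (cmeval v)); split=> [c|i].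
  by rewrite malg_CE; apply: mmapC.
by rewrite /malg_X -lock [LHS]mmapU /= (rmorph1 f) mul1r cmevalU.
Qed.

Lemma malgUM (c d : R) (k l : K) :
  << c *g k >> * << d *g l >> = << c * d *g mmul k l >> :> P.
Proof. by rewrite malgM_def fgmulUU. Qed.

Lemma malgXM i (c : R) (k : K) :
  malg_X i * << c *g k >> = << c *g mmul (ucm i) k >>.
Proof. by rewrite /malg_X -lock [LHS]malgUM mul1r. Qed.

Lemma malgCM (a c : R) (k : K) :
  malg_C a * << c *g k >> = << a * c *g k >> :> P.
Proof. by rewrite malg_CE [LHS]malgUM mul1m. Qed.

Lemma malg_ind (Q : P -> Prop) :
  Q 0 -> (forall e e', Q e -> Q e' -> Q (e + e')) ->
  (forall c k, Q << c *g k >>) -> forall e, Q e.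
Proof. by move=> Q0 QD QU e; rewrite [e]monalgE; elim/big_ind: _. Qed.

Lemma malg_hom_ext (S : comNzRingType) (g h : {rmorphism P -> S}) :
  (forall c, g (malg_C c) = h (malg_C c)) ->
  (forall i, g (malg_X i) = h (malg_X i)) -> g =1 h.
Proof.
move=> gC gX; elim/malg_ind => [|e e' IH IH'|c k].
- by rewrite !rmorph0.
- by rewrite !rmorphD IH IH'.
elim/cmonom_ind: k => [|i k IHk]; first by rewrite -malg_CE.
rewrite -malgXM (rmorphM g) (rmorphM h); exact: (congr2 *%R (gX i) IHk).
Qed.

Section Scale.
Context (w : I -> R) (g : {rmorphism P -> P}).
Context (gC : forall c, g (malg_C c) = malg_C c).
Context (gX : forall i, g (malg_X i) = malg_C (w i) * malg_X i).

Lemma malg_scaleU c k : g << c *g k >> = << c * cmeval w k *g k >>.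
Proof.
elim/cmonom_ind: k => [|i k IHk].
  by rewrite (mmorph1 (cmeval w)) mulr1 -malg_CE.
rewrite -malgXM; apply: etrans (rmorphM (g) _ _) _.
apply: etrans (congr2 *%R (gX i) IHk) _.
apply: etrans (esym (mulrA _ _ _)) _.
apply: etrans (congr1 ( *%R (malg_C (w i))) (malgXM _ _ _)) _.
apply: etrans (malgCM _ _ _) _; congr << _ *g _ >>.
by rewrite (mmorphM (cmeval w)) /= cmevalU mulrCA.
Qed.

Lemma malg_scaleE e k : (g e)@_k = e@_k * cmeval w k.
Proof.
elim/malg_ind: e => [|e e' IH IH'|c l].
- by rewrite rmorph0 !mcoeff0 mul0r.
- rewrite rmorphD (mcoeffD k (g e)) IH IH' -mulrDl.
  by rewrite (mcoeffD k e).
have e1 : (g << c *g l >>)@_k = (c * cmeval w l) *+ (l == k).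
  by rewrite malg_scaleU; apply: mcoeffU.
have e2 : (<< c *g l >> : P)@_k = c *+ (l == k) by apply: mcoeffU.
by rewrite e1 e2; case: (l =P k) => [->|_] //=; rewrite mul0r.
Qed.

End Scale.

Lemma malg_coef_mul (e : P) (q : K -> R) :
  exists e' : P, forall k, e'@_k = e@_k * q k.
Proof.
exists (\sum_(k <- msupp e) << e@_k * q k *g k >>) => k.
rewrite raddf_sum /=.
transitivity (\sum_(l <- msupp e) (e@_l * q l) *+ (l == k)).
  by apply: eq_bigr => l _; apply: mcoeffU.
case: (msuppP e k) => [kS|kS].
  rewrite (big_fsetD1 k) //= eqxx mulr1n big1_fset ?addr0 // => l.
  by rewrite in_fsetD1 => /andP[/negbTE->].
rewrite mul0r big1_fset // => l lS _.
by case: eqP => // lk; rewrite lk (negbTE kS) in lS.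
Qed.

Definition malg_poly_ring : poly_ring I R.
Proof.
refine (@PolyRing I R P malg_C malg_X (fun e k => e@_k) malg_eval_exists
  malg_hom_ext _ _ _ malg_coef_mul malg_scaleE).
- by move=> e e' ee'; apply/malgP.
- by move=> c e k; rewrite malg_CE mcoeffCM.
- by move=> e; exists (msupp e) => k; apply: mcoeff_outdom.
Defined.

End MalgPolyRing.

(** * Shift, dilation and evaluation of the parameters *)

Section PolynomialParam.
Context (R : comNzRingType) (sigma : {rmorphism R -> R}).
Context (P : poly_ring (bool * nat)%type R).

Local Notation K := {cmonom (bool * nat)%type}.
Local Notation polyC := (polyC P).
Local Notation polyX := (polyX P).
Local Notation "e @_ k" := (poly_coef e k).

Section Evaluation.
Context (S : comNzRingType) (f : {rmorphism R -> S}) (v : bool * nat -> S).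

Definition poly_eval : {rmorphism P -> S} :=
  sval (cid (poly_eval_exists P f v)).

Lemma poly_evalC c : poly_eval (polyC c) = f c.
Proof. exact: (svalP (cid (poly_eval_exists P f v))).1. Qed.

Lemma poly_evalX i : poly_eval (polyX i) = v i.
Proof. exact: (svalP (cid (poly_eval_exists P f v))).2. Qed.

End Evaluation.

Lemma poly_coef0 k : (0 : P)@_k = 0.
Proof. by rewrite -[0 in LHS](mul0r 0) -(rmorph0 polyC) poly_coefCM mul0r. Qed.

Definition shift_sigma : {rmorphism P -> P} :=
  poly_eval (polyC \o sigma) (fun v => polyX (v.1, v.2.+1)).

(** The index [(false, i)] stands for [y_i] and [(true, i)] for [z_i]. *)
Definition dilation (s : R) (v : bool * nat) : R :=
  if v.1 then iter v.2 sigma s else 1.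

Definition poly_tau (s : R) : {rmorphism P -> P} :=
  poly_eval polyC (fun v => polyC (dilation s v) * polyX v).

Definition poly_ev (c r : R) : {rmorphism P -> R} :=
  poly_eval idfun (fun v => iter v.2 sigma (if v.1 then r else c)).

Lemma poly_tauC s a : poly_tau s (polyC a) = polyC a.
Proof. exact: poly_evalC. Qed.

Lemma poly_tauX s v : poly_tau s (polyX v) = polyC (dilation s v) * polyX v.
Proof. exact: poly_evalX. Qed.

Lemma poly_tauE s e k : (poly_tau s e)@_k = e@_k * cmeval (dilation s) k.
Proof. exact: poly_scaleE (poly_tauC s) (poly_tauX s) e k. Qed.

Lemma poly_tau_sigma s e :
  poly_tau s (shift_sigma e) = shift_sigma (poly_tau s e).
Proof.
apply: (poly_hom_ext (g := poly_tau s \o shift_sigma)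
  (h := shift_sigma \o poly_tau s)) => [c|v] /=.
  by rewrite poly_evalC !poly_tauC poly_evalC.
rewrite poly_evalX !poly_tauX rmorphM poly_evalC poly_evalX.
congr (_ * _); congr (polyC _); rewrite /dilation /=.
by case: v => [[] i] //=; rewrite rmorph1.
Qed.

Lemma poly_tauM s t e : poly_tau s (poly_tau t e) = poly_tau (s * t) e.
Proof.
apply: (poly_hom_ext (g := poly_tau s \o poly_tau t)) => [c|v] /=.
  by rewrite !poly_tauC.
rewrite !poly_tauX rmorphM poly_tauC poly_tauX mulrA -rmorphM; congr (_ * _).
congr (polyC _); rewrite /dilation; case: v => [[] i] /=; last by rewrite mulr1.
by rewrite iter_sigmaM mulrC.
Qed.

Lemma poly_ev_sigma c r e : poly_ev c r (shift_sigma e) = sigma (poly_ev c r e).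
Proof.
apply: (poly_hom_ext (g := poly_ev c r \o shift_sigma)
  (h := sigma \o poly_ev c r)) => [d|v] /=.
  by rewrite !poly_evalC.
by rewrite !poly_evalX.
Qed.

Lemma dilation_finsupp (k : K) :
  (exists i, (true, i) \in finsupp k) \/ forall s, cmeval (dilation s) k = 1.
Proof.
have [[i ik]|nk] := pselect (exists i, (true, i) \in finsupp k).
  by left; exists i.
right=> s; rewrite /cmeval big1_fset // => -[[] i] ik _.
  by case: nk; exists i.
by rewrite /dilation expr1n.
Qed.

(** Since [e] vanishes at [z = 0], each of its monomials contains some [z_i], and dilation
    multiplies the coefficient by [sigma^i(s)], a multiple of [t]. *)
Lemma dilation_dvd (e : P) : poly_tau 0 e = 0 -> exists N, forall t s,
  (forall i, (i < N)%N -> exists w, iter i sigma s = t * w) ->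
  forall k, exists q, e@_k * cmeval (dilation s) k = t * (e@_k * q) /\
    e@_k * q * cmeval (dilation 0) k = 0.
Proof.
move=> e0.
have ek k : e@_k * cmeval (dilation 0) k = 0.
  by rewrite -poly_tauE e0 poly_coef0.
have [r rP] := poly_coef_supp e.
(* A bound exceeding the index of every variable that occurs in [e]. *)
pose N := \max_(k <- r) \max_(v <- finsupp k) v.2.+1.
exists N => t s sN k.
have [kr|/rP ->] := boolP (k \in r); last by exists 0; rewrite !mul0r mulr0.
case: (dilation_finsupp k) => [[i ik]|k1]; last first.
  by exists 0; move: (ek k); rewrite !k1 !mulr1 => ->; rewrite !mul0r mulr0.
have [|w wE] := sN i.
  apply: (@leq_trans (\max_(v <- finsupp k) v.2.+1)).
    exact: (leq_bigmax_seq (F := fun v : bool * nat => v.2.+1) (true, i)).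
  exact: (leq_bigmax_seq (F := fun k : K => \max_(v <- finsupp k) v.2.+1) k).
have ki : k (true, i) = (k (true, i)).-1.+1.
  by rewrite prednK // lt0n cmE_neq0.
(* What is left of the dilation factor when [t] is taken out of one of the factors
   [sigma^i(s) = t w]. *)
exists (w * (t * w) ^+ (k (true, i)).-1 *
  \prod_(v <- (finsupp k `\ (true, i))%fset) dilation s v ^+ k v).
split; last by rewrite mulrAC ek mul0r.
rewrite {1}/cmeval (big_fsetD1 _ ik) /= {1}/dilation /= wE {1}ki exprS.
by rewrite -!mulrA [RHS]mulrCA [t * (w * _)]mulrCA.
Qed.

Lemma poly_lift (e : P) : poly_tau 0 e = 0 -> exists N, forall t s,
  (forall i, (i < N)%N -> exists w, iter i sigma s = t * w) ->
  exists2 e', poly_tau 0 e' = 0 & poly_tau s e = polyC t * e'.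
Proof.
move=> e0; have [N sN] := dilation_dvd e0; exists N => t s /sN qP.
pose q k := sval (cid (qP k)).
have qE k : e@_k * cmeval (dilation s) k = t * (e@_k * q k).
  by rewrite /q; case: cid => ? [].
have q0 k : e@_k * q k * cmeval (dilation 0) k = 0.
  by rewrite /q; case: cid => ? [].
have [e' e'E] := poly_coef_mul e q.
exists e'; apply: poly_coef_ext => k.
  by rewrite poly_tauE e'E q0 poly_coef0.
by rewrite poly_tauE poly_coefCM e'E qE.
Qed.

(** By [dilation_dvd] with [t = u], each new coefficient is a multiple of [u] times the old one,
    which is zero. *)
Lemma poly_kill u (e : P) : poly_tau 0 e = 0 -> polyC u * e = 0 ->
  exists N, forall s,
  (forall i, (i < N)%N -> exists w, iter i sigma s = u * w) ->
  poly_tau s e = 0.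
Proof.
move=> e0 ue0; have [N sN] := dilation_dvd e0; exists N => s /sN qP.
apply: poly_coef_ext => k; have [q [qE _]] := qP k.
by rewrite poly_tauE qE mulrA -poly_coefCM ue0 poly_coef0 mul0r.
Qed.

Definition poly_param : param_ring sigma.
Proof.
refine (@ParamRing R sigma P shift_sigma (polyC) (polyX (false, 0%N))
  (polyX (true, 0%N)) poly_tau poly_ev _ poly_tau_sigma poly_tauC _ _ poly_tauM
  poly_ev_sigma _ _ _ poly_lift poly_kill).
- by move=> a; rewrite poly_evalC.
- by move=> s; rewrite poly_tauX rmorph1 mul1r.
- by move=> s; rewrite poly_tauX.
- by move=> c r a; rewrite /poly_ev poly_evalC.
- by move=> c r; rewrite /poly_ev poly_evalX.
- by move=> c r; rewrite /poly_ev poly_evalX.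
Defined.

End PolynomialParam.

Lemma param_ring_exists (R : comPzRingType) (sigma : {rmorphism R -> R}) :
  (1 : R) != 0 -> exists _ : param_ring sigma, True.
Proof.
(* The structure is taken apart so that the nonzero ring [R'] rebuilt from the same pieces has [R]
   as its underlying ring by conversion. *)
move=> R10; destruct R as [T cT]; destruct cT.
pose nz := GRing.PzSemiRing_isNonZero.Build _ R10.
match type of sigma with context [GRing.ComPzRing.Pack ?c] =>
  pose R' : comNzRingType := HB.pack T c nz end.
by exists (@poly_param R' sigma (malg_poly_ring _ R')).
Qed.

Lemma mx_equiv_kernel (T T' : pzRingType) (f : {rmorphism T -> T'}) p q p' q'
    (K : 'M[T]_(p, q)) (L : 'M[T]_(p', q')) P B P' B' Q Q' :
  map_mx f (K *m P - B *m L) = 0 -> map_mx f (L *m P' - B' *m K) = 0 ->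
  map_mx f (P *m P' - (1%:M + Q *m K)) = 0 ->
  map_mx f (P' *m P - (1%:M + Q' *m L)) = 0 ->
  mx_equiv (map_mx f K) (map_mx f L).
Proof.
rewrite !rmap_mxB !map_mxD !map_mxM !map_mx1.
move=> /subr0_eq e1 /subr0_eq e2 /subr0_eq e3 /subr0_eq e4.
exists (map_mx f P), (map_mx f B), (map_mx f P'), (map_mx f B').
by exists (map_mx f Q), (map_mx f Q').
Qed.

(** * Conditions satisfied by all sufficiently divisible dilations *)

Section NearMaximal.
Context (R : comPzRingType) (sigma : {rmorphism R -> R}) (m : max_spec R).

(** The ideal generated by [m] and [t] contains 1, by maximality. *)
Lemma max_inv (t : R) : t \notin m -> exists a, 1 - a * t \in m.
Proof.
move=> tm; have [[m0 mI] m1 mM] := max_specP m.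
pose J : {pred R} := fun x => `[< exists r i, i \in m /\ x = r * t + i >].
have JP x : reflect (exists r i, i \in m /\ x = r * t + i) (x \in J).
  exact: asboolP.
have Jid : ideal J.
  split; first by apply/JP; exists 0, 0; rewrite mul0r addr0.
  move=> a _ _ /JP[r [i [im ->]]] /JP[r' [i' [i'm ->]]]; apply/JP.
  by exists (a * r + r'), (a * i + i'); rewrite mI //; split=> //; ring.
have [/JP[r [i [im e]]]|J1] := boolP (1 \in J).
  by exists r; rewrite e addrC addKr.
case/negP: tm; apply: (mM J Jid J1) => [i im|]; apply/JP.
  by exists 0, i; rewrite mul0r add0r.
by exists 1, 0; rewrite mul1r addr0.
Qed.

Lemma maxN_mul (s t : R) : s \notin m -> t \notin m -> s * t \notin m.
Proof. by move=> sm tm; apply: (max_compl_mulr_closed m).2. Qed.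

Context (sigma_bij : bijective sigma).
Context (sigma_max : forall s, s \notin m -> sigma s \notin m).

(* sigma^-1(m) is contained in m by hypothesis, hence equal to it. *)
Lemma maxN_sigma_inv (t : R) :
  t \notin m -> exists2 s, s \notin m & sigma s = t.
Proof.
move=> tm; have [g gK sK] := sigma_bij; exists (g t); last exact: sK.
apply/negP => gm; have [a am] := max_inv tm.
have [[m0 mI] m1 _] := max_specP m.
case/negP: m1; have -> : 1 = g a * g t + (1 - g a * g t) by ring.
rewrite mI //; apply: contraLR am => /sigma_max.
by rewrite rmorphB rmorphM rmorph1 !sK.
Qed.

(** Such conditions are closed under finite conjunction, and [near_max_ex] finds an [s] outside [m]
    satisfying them; this replaces explicit bookkeeping of common denominators. *)
Definition near_max (P : R -> Prop) : Prop :=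
  exists2 t, t \notin m & exists N, forall s,
    (forall i, (i < N)%N -> exists w, iter i sigma s = t * w) -> P s.

Lemma near_maxT (P : R -> Prop) : (forall s, P s) -> near_max P.
Proof.
by move=> Ps; have [_ m1 _] := max_specP m; exists 1 => //; exists 0%N.
Qed.

Lemma near_maxS (P Q : R -> Prop) :
  (forall s, P s -> Q s) -> near_max P -> near_max Q.
Proof.
by move=> PQ [t tm [N tP]]; exists t => //; exists N => s /tP/PQ.
Qed.

Lemma near_maxI (P Q : R -> Prop) :
  near_max P -> near_max Q -> near_max (fun s => P s /\ Q s).
Proof.
move=> [t tm [N tP]] [u um [N' uQ]]; exists (t * u); first exact: maxN_mul.
exists (maxn N N') => s sN; split.
  apply: tP => i iN; have [|w ->] := sN i; first by rewrite leq_max iN.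
  by exists (u * w); rewrite mulrA.
apply: uQ => i iN; have [|w ->] := sN i; first by rewrite leq_max iN orbT.
by exists (t * w); rewrite mulrCA mulrA.
Qed.

Lemma near_max_all (I : eqType) (r : seq I) (P : I -> R -> Prop) :
  (forall i, near_max (P i)) ->
  near_max (fun s => forall i, i \in r -> P i s).
Proof.
move=> nP; elim: r => [|j r IHr]; first exact: near_maxT.
apply: near_maxS (near_maxI (nP j) IHr) => s [Pj Pr] i.
by rewrite inE => /predU1P[->|/Pr].
Qed.

Lemma near_max_finite (I : finType) (P : I -> R -> Prop) :
  (forall i, near_max (P i)) -> near_max (fun s => forall i, P i s).
Proof.
move=> /near_max_all-/(_ (enum I)); apply: near_maxS => s Ps i.
by apply: Ps; rewrite mem_enum.
Qed.

(* The witness is \prod_(i < N) sigma^-i(t). *)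
Lemma near_max_ex (P : R -> Prop) : near_max P -> exists2 s, s \notin m & P s.
Proof.
case=> t tm [N tP].
suff [s sm sN] : exists2 s, s \notin m &
    forall i, (i < N)%N -> exists w, iter i sigma s = t * w.
  by exists s => //; apply: tP.
elim: N {P tP} => [|N [s sm sN]]; first by exists t.
have [s' s'm s'E] := maxN_sigma_inv sm.
exists (t * s'); first exact: maxN_mul.
move=> [_|i iN]; first by exists s'.
have [w wE] := sN i iN; exists (w * iter i sigma (sigma t)).
by rewrite iterSr rmorphM s'E iter_sigmaM wE; ring.
Qed.

End NearMaximal.

(** * From an equivalence over the localization to one over the ring *)

Section LocalEquivalence.
Context (R : comPzRingType) (sigma : {rmorphism R -> R}) (m : max_spec R).
Context (sigma_bij : bijective sigma).
Context (sigma_max : forall s, s \notin m -> sigma s \notin m).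
Context (F : param_ring sigma) (n : nat).

Local Notation near := (near_max sigma m).
Local Notation C := (param_C F).
Local Notation tau := (@param_tau R sigma F).

(** Only constants are inverted, so [param_sigma] and every dilation extend to the localization. *)
Definition param_den : {pred F} :=
  fun x => `[< exists2 s, s \notin m & x = C s >].

Lemma param_denP x :
  reflect (exists2 s, s \notin m & x = C s) (x \in param_den).
Proof. exact: asboolP. Qed.

Fact param_den_mulr_closed : mulr_closed param_den.
Proof.
split=> [|_ _ /param_denP[s sm ->] /param_denP[t tm ->]]; apply/param_denP.
  by exists 1; rewrite ?rmorph1 //; have [] := max_specP m.
by exists (s * t); rewrite ?rmorphM //; apply: maxN_mul.
Qed.

HB.instance Definition _ :=
  GRing.isMulClosed.Build F param_den param_den_mulr_closed.

Lemma param_C_den s : s \in max_compl m -> C s \in param_den.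
Proof. by move=> sm; apply/param_denP; exists s. Qed.

Lemma param_sigma_den x : x \in param_den -> param_sigma F x \in param_den.
Proof.
move=> /param_denP[s sm ->]; apply/param_denP; exists (sigma s).
  exact: sigma_max.
by rewrite param_Csigma.
Qed.

Lemma param_tau_den s x : x \in param_den -> tau s x \in param_den.
Proof.
by move=> /param_denP[t tm ->]; apply/param_denP; exists t; rewrite ?param_tauC.
Qed.

Local Notation L := (loc param_den).
Local Notation sigmaL := (loc_endo param_sigma_den).
Local Notation tauL s := (loc_endo (@param_tau_den s)).
Local Notation A1 := (ore n (param_sigma F)).
Local Notation AL := (ore n sigmaL).

Lemma tauL_sigma s p : tauL s (sigmaL p) = sigmaL (tauL s p).
Proof.
have [x ->] := loc_pi_surj p; rewrite /= !loc_endoE.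
by apply: loc_eqI; rewrite /= !param_tau_sigma.
Qed.

Definition tau_ore s : {rmorphism A1 -> A1} :=
  ore_map n (@param_tau_sigma _ _ F s).
Definition tauL_ore s : {rmorphism AL -> AL} := ore_map n (@tauL_sigma s).
Local Notation locA := (ore_loc n param_sigma_den : {rmorphism A1 -> AL}).

(** For [p = f / C t], some [C u] makes [C u * f] vanish at [z = 0]. A suitable dilation makes that
    product divisible by [C (u * t)]: the factor [t] clears the denominator and [u] cancels in the
    localization. *)
Lemma lift_loc (p : L) : tauL 0 p = 0 ->
  near (fun s => exists2 e, tau 0 e = 0 & tauL s p = loc_of _ e).
Proof.
have [[f [d dS]] ->] := loc_pi_surj p.
have /param_denP[t tm dE] := dS.
rewrite [X in X = _]loc_endoE => /loc_pi_eq[_ /param_denP[u um ->]] /=.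
rewrite mulr1 mul0r mulr0 => uf0.
have [N NP] : exists N, forall t s,
    (forall i, (i < N)%N -> exists w, iter i sigma s = t * w) ->
    exists2 e', tau 0 e' = 0 & tau s (C u * f) = C t * e'.
  by apply: param_lift; rewrite rmorphM param_tauC.
exists (u * t); first exact: maxN_mul.
exists N => s /NP[e e0 eE]; exists e => //.
rewrite [LHS]loc_endoE; apply/loc_pi_eq; exists (C u).
  exact: param_C_den.
rewrite /= mulr1 dE param_tauC.
by move: eE; rewrite !rmorphM param_tauC => ->; ring.
Qed.

(** Only the finitely many coefficients in the support impose a condition. *)
Lemma lift_ore (f : AL) : tauL_ore 0 f = 0 ->
  near (fun s => exists2 e, tau_ore 0 e = 0 & tauL_ore s f = locA e).
Proof.
move=> f0.
have fP a : near (fun s => exists2 e, tau 0 e = 0 & tauL s f@_a = loc_of _ e).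
  apply: lift_loc; have := congr1 (mcoeff a) f0.
  by rewrite ore_mapE mcoeff0.
apply: near_maxS (near_max_all (msupp f) fP) => s sP.
(* The lift is fixed to be 0 off the support, so that the finite sum [g] has coefficient [e a]
   everywhere. *)
have sP' a : exists e, [/\ tau 0 e = 0, tauL s f@_a = loc_of _ e
    & a \notin msupp f -> e = 0].
  have [/sP[e e0 eE]|af] := boolP (a \in msupp f); first by exists e.
  by exists 0; rewrite !rmorph0 (mcoeff_outdom af) rmorph0.
pose e a := sval (cid (sP' a)).
pose g : A1 := \sum_(a <- msupp f) oreU _ (e a) a.
have gE a : g@_a = e a.
  rewrite /g raddf_sum /=; case: (boolP (a \in msupp f)) => af.
    rewrite (big_fsetD1 a) //= oreU_coeff eqxx big1_fset ?addr0 // => b.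
    by rewrite in_fsetD1 oreU_coeff => /andP[/negbTE->].
  rewrite big1_fset => [|b bf _]; last first.
    by rewrite oreU_coeff; case: eqP => // ba; rewrite ba (negbTE af) in bf.
  by rewrite /e; case: cid => ? [_ _] /= /(_ af).
exists g; apply/malgP => a; rewrite !ore_mapE gE ?mcoeff0 /e;
  by case: cid => e' [].
Qed.

(** Each coefficient is annihilated by a constant outside [m], so [param_kill] applies to it. *)
Lemma kill_ore (f : A1) : tau_ore 0 f = 0 -> locA f = 0 ->
  near (fun s => tau_ore s f = 0).
Proof.
move=> f0 lf0.
have fP a : near (fun s => tau s f@_a = 0).
  have := congr1 (mcoeff a) lf0; rewrite ore_mapE mcoeff0.
  move=> /loc_of_eq0[_ /param_denP[u um ->]] /param_kill[|N NP].
    by have := congr1 (mcoeff a) f0; rewrite ore_mapE mcoeff0.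
  by exists u => //; exists N.
apply: near_maxS (near_max_all (msupp f) fP) => s sP.
apply/malgP => a; rewrite ore_mapE mcoeff0.
by case: (msuppP f a) => [/sP|_] //; rewrite rmorph0.
Qed.

Lemma lift_mx p q (E : 'M[AL]_(p, q)) : map_mx (tauL_ore 0) E = 0 ->
  near (fun s => exists2 E' : 'M[A1]_(p, q), map_mx (tau_ore 0) E' = 0
    & map_mx (tauL_ore s) E = map_mx locA E').
Proof.
move=> E0.
have EP (ij : 'I_p * 'I_q) : near (fun s => exists2 e, tau_ore 0 e = 0 &
    tauL_ore s (E ij.1 ij.2) = locA e).
  by apply: lift_ore; have /matrixP/(_ ij.1 ij.2) := E0; rewrite !mxE.
apply: near_maxS (near_max_finite EP) => s sP.
pose e i j := s2val (cid2 (sP (i, j))).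
exists (\matrix_(i, j) e i j); apply/matrixP => i j; rewrite !mxE /e.
  by case: cid2.
by case: cid2.
Qed.

Lemma kill_mx p q (E : 'M[A1]_(p, q)) :
  map_mx (tau_ore 0) E = 0 -> map_mx locA E = 0 ->
  near (fun s => map_mx (tau_ore s) E = 0).
Proof.
move=> E0 lE0.
have EP (ij : 'I_p * 'I_q) : near (fun s => tau_ore s (E ij.1 ij.2) = 0).
  apply: kill_ore.
    by have /matrixP/(_ ij.1 ij.2) := E0; rewrite !mxE.
  by have /matrixP/(_ ij.1 ij.2) := lE0; rewrite !mxE.
apply: near_maxS (near_max_finite EP) => s sP.
by apply/matrixP => i j; rewrite !mxE (sP (i, j)).
Qed.

Lemma tau_oreM s t f : tau_ore s (tau_ore t f) = tau_ore (s * t) f.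
Proof. by apply/malgP => a; rewrite !ore_mapE param_tauM. Qed.

Lemma locA_tau s f : locA (tau_ore s f) = tauL_ore s (locA f).
Proof.
apply/malgP => a; rewrite !ore_mapE.
exact: (loc_endo_of (@param_tau_den s)).
Qed.

(** Here [E - 1] vanishes at [z = 0], so it is lifted and 1 is added back. *)
Lemma lift_mx1 p (E : 'M[AL]_p) : map_mx (tauL_ore 0) E = 1%:M ->
  near (fun s => exists2 E' : 'M[A1]_p, map_mx (tau_ore 0) E' = 1%:M
    & map_mx (tauL_ore s) E = map_mx locA E').
Proof.
move=> E1; have /lift_mx : map_mx (tauL_ore 0) (E - 1%:M) = 0.
  by rewrite rmap_mxB E1 map_mx1 subrr.
apply: near_maxS => s [E' E'0 E'E]; exists (1%:M + E').
  by rewrite map_mxD map_mx1 E'0 addr0.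
by rewrite map_mxD map_mx1 -E'E rmap_mxB map_mx1 addrC subrK.
Qed.

(** Two dilations are used: the first by [s] makes the matrices integral, the second by [u] turns
    the identities, so far valid only in the localization, into identities over [A1]. Their
    composite is the dilation by [u * s]. *)
Lemma lift_split_equiv p q (K K' : 'M[A1]_(p, q)) :
  map_mx (tau_ore 0) K = map_mx (tau_ore 0) K' ->
  split_equiv (tauL_ore 0) (map_mx locA K) (map_mx locA K') ->
  exists2 s, s \notin m &
    mx_equiv (map_mx (tau_ore s) K) (map_mx (tau_ore s) K').
Proof.
move=> K0 [P [D [P' [D' [Q [Q' [[KP KP' PP' P'P]]]]]]]].
case=> -[/lift_mx1 nP /lift_mx1 nP'] [/lift_mx1 nD /lift_mx1 nD'].
case=> /lift_mx nQ /lift_mx nQ'.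
have [s sm] := near_max_ex sigma_bij sigma_max
  (near_maxI (near_maxI nP nP')
     (near_maxI (near_maxI nD nD') (near_maxI nQ nQ'))).
case=> -[[p0 p0e pE] [p0' p0'e pE']] [[[d de dE] [d' d'e dE']]].
case=> [[q0 q0e qE] [q0' q0'e qE']].
have locK (J : 'M[A1]_(p, q)) :
    map_mx locA (map_mx (tau_ore s) J) = map_mx (tauL_ore s) (map_mx locA J).
  by apply/matrixP => i j; rewrite !mxE locA_tau.
have epsK (J : 'M[A1]_(p, q)) :
    map_mx (tau_ore 0) (map_mx (tau_ore s) J) = map_mx (tau_ore 0) J.
  by apply/matrixP => i j; rewrite !mxE tau_oreM mul0r.
(* The error in each identity vanishes at [z = 0], by the values of the lifts there, and in the
   localization, by the given equivalence; hence [kill_mx] applies. *)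
have n1 : near (fun u => map_mx (tau_ore u)
    (map_mx (tau_ore s) K *m p0 - d *m map_mx (tau_ore s) K') = 0).
  apply: kill_mx; rewrite rmap_mxB !map_mxM.
    by rewrite !epsK p0e de mulmx1 mul1mx K0 subrr.
  by rewrite !locK -pE -dE -!map_mxM KP subrr.
have n2 : near (fun u => map_mx (tau_ore u)
    (map_mx (tau_ore s) K' *m p0' - d' *m map_mx (tau_ore s) K) = 0).
  apply: kill_mx; rewrite rmap_mxB !map_mxM.
    by rewrite !epsK p0'e d'e mulmx1 mul1mx K0 subrr.
  by rewrite !locK -pE' -dE' -!map_mxM KP' subrr.
have n3 : near (fun u => map_mx (tau_ore u)
    (p0 *m p0' - (1%:M + q0 *m map_mx (tau_ore s) K)) = 0).
  apply: kill_mx; rewrite rmap_mxB map_mxD !map_mxM map_mx1.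
    by rewrite p0e p0'e q0e mul0mx addr0 mulmx1 subrr.
  rewrite locK -pE -pE' -qE -!map_mxM PP' map_mxD map_mx1 map_mxM.
  by rewrite subrr.
have n4 : near (fun u => map_mx (tau_ore u)
    (p0' *m p0 - (1%:M + q0' *m map_mx (tau_ore s) K')) = 0).
  apply: kill_mx; rewrite rmap_mxB map_mxD !map_mxM map_mx1.
    by rewrite p0e p0'e q0'e mul0mx addr0 mulmx1 subrr.
  rewrite locK -pE -pE' -qE' -!map_mxM P'P map_mxD map_mx1 map_mxM.
  by rewrite subrr.
have [u um] := near_max_ex sigma_bij sigma_max
  (near_maxI (near_maxI n1 n2) (near_maxI n3 n4)).
case=> -[e1 e2] [e3 e4]; exists (u * s); first exact: maxN_mul.
have tauJ (J : 'M[A1]_(p, q)) :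
    map_mx (tau_ore (u * s)) J = map_mx (tau_ore u) (map_mx (tau_ore s) J).
  by apply/matrixP => i j; rewrite !mxE tau_oreM.
rewrite (tauJ K) (tauJ K'); exact: mx_equiv_kernel e1 e2 e3 e4.
Qed.

Definition paramL : {rmorphism loc_max m -> L} := loc_map param_C_den.

Lemma paramL_sigma p : paramL (endo_max sigma_max p) = sigmaL (paramL p).
Proof. by apply: loc_map_endo; apply: param_Csigma. Qed.

Definition twist_param (c : F) : {rmorphism ore n sigma -> A1} :=
  ore_twist n (@param_Csigma _ _ F) c.

Definition twistL_param (c : F) :
    {rmorphism ore n (endo_max sigma_max) -> AL} :=
  ore_twist n paramL_sigma (loc_of param_den c).

Lemma twistL_paramE c f :
  twistL_param c (ore_max n sigma_max f) = locA (twist_param c f).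
Proof.
apply/malgP => a; rewrite ore_twistE !ore_mapE ore_twistE rmorphM.
rewrite (rmorph_skew_exp (loc_endo_of param_sigma_den)).
by rewrite [paramL _]loc_map_of.
Qed.

Lemma tauL_twistL s c f :
  tauL_ore s (twistL_param c f) = twistL_param (tau s c) f.
Proof.
apply/malgP => a; rewrite ore_mapE !ore_twistE rmorphM.
rewrite (rmorph_skew_exp (@tauL_sigma s)) -loc_endo_of; congr (_ * _).
have [x ->] := loc_pi_surj f@_a.
rewrite /= loc_mapE [LHS]loc_endoE.
by apply: loc_eqI; rewrite /= !param_tauC.
Qed.

Lemma tau_twist s c f : tau_ore s (twist_param c f) = twist_param (tau s c) f.
Proof.
apply/malgP => a; rewrite ore_mapE !ore_twistE rmorphM param_tauC.
by rewrite (rmorph_skew_exp (@param_tau_sigma _ _ F s)).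
Qed.

(** The endomorphism [x_i |-> c x_i] of the Ore extension. *)
Definition dilate (c : R) : {rmorphism ore n sigma -> ore n sigma} :=
  ore_twist n (sigma := sigma) (theta := idfun) (fun=> erefl) c.

Lemma ev_twist c r a f :
  ore_map n (@param_ev_sigma _ _ F c r) (twist_param a f) =
  dilate (param_ev F c r a) f.
Proof.
apply/malgP => k; rewrite ore_mapE !ore_twistE rmorphM param_evC.
by rewrite (rmorph_skew_exp (@param_ev_sigma _ _ F c r)).
Qed.

Lemma mx_equiv_dilate p q (K : 'M[ore n sigma]_(p, q)) p' q'
    (L : 'M[loc_max m]_(p', q')) :
  mx_equiv (map_mx (ore_max n sigma_max) K)
    (map_mx (oreC n (endo_max sigma_max)) L) ->
  exists2 s, s \notin m & forall c r,
    mx_equiv (map_mx (dilate (c + s * r)) K) (map_mx (dilate c) K).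
Proof.
move=> KL.
have tau_y s : tau s (param_y F + param_z F) = param_y F + C s * param_z F.
  by rewrite rmorphD param_tauy param_tauz.
have tau0_y : tau 0 (param_y F + param_z F) = param_y F.
  by rewrite tau_y rmorph0 mul0r addr0.
have yz f : tauL_ore 0 (twistL_param (param_y F + param_z F) f) =
    tauL_ore 0 (twistL_param (param_y F) f).
  by rewrite !tauL_twistL tau0_y param_tauy.
(* Twists move only the variables, so they agree on a matrix of constants. *)
have yzC : map_mx (twistL_param (param_y F + param_z F))
      (map_mx (oreC n (endo_max sigma_max)) L) =
    map_mx (twistL_param (param_y F)) (map_mx (oreC n (endo_max sigma_max)) L).
  by apply/matrixP => i j; rewrite !mxE [LHS]ore_twistC [RHS]ore_twistC.
have KE c : map_mx (twistL_param c) (map_mx (ore_max n sigma_max) K) =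
    map_mx locA (map_mx (twist_param c) K).
  by apply/matrixP => i j; rewrite !mxE twistL_paramE.
have := mx_equiv_split yz yzC KL; rewrite !KE => /lift_split_equiv[|s sm sK].
  by apply/matrixP => i j; rewrite !mxE !tau_twist tau0_y param_tauy.
exists s => // c r.
(* Evaluating [y] at [c] and [z] at [r] sends [y + s z] to [c + s r]. *)
have /(map_mx_equiv (ore_map n (@param_ev_sigma _ _ F c r))) := sK.
have -> : map_mx (ore_map n (@param_ev_sigma _ _ F c r)) (map_mx (tau_ore s)
    (map_mx (twist_param (param_y F + param_z F)) K)) =
    map_mx (dilate (c + s * r)) K.
  apply/matrixP => i j; rewrite !mxE tau_twist ev_twist tau_y.
  by rewrite rmorphD rmorphM param_evy param_evz param_evC.
have -> // : map_mx (ore_map n (@param_ev_sigma _ _ F c r)) (map_mx (tau_ore s)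
    (map_mx (twist_param (param_y F)) K)) = map_mx (dilate c) K.
by apply/matrixP => i j; rewrite !mxE tau_twist ev_twist param_tauy param_evy.
Qed.

End LocalEquivalence.

(** * Existence of maximal ideals *)

Section MaximalIdeals.
Context (R : comPzRingType).

Lemma ideal_sub_max (I : {pred R}) : ideal I -> 1 \notin I ->
  exists m : max_spec R, {subset I <= m}.
Proof.
move=> [I0 IB] I1.
(* Zorn's lemma is applied to sets [A] whose union with [I] is a proper ideal. Adjoining [I] covers
   the empty chain, whose union then gives [I] itself. *)
pose J (A : set R) : {pred R} := fun x => `[< x \in I \/ A x >].
have JP A x : reflect (x \in I \/ A x) (x \in J A) by apply: asboolP.
pose P (A : set R) := ideal (J A) /\ 1 \notin J A.
have [|A [[JA JA1] Amax]] := @Zorn_bigcup R P.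
  move=> H HP Htot.
  have JU x : x \in J (\bigcup_(X in H) X)%classic ->
      x \in I \/ exists2 X, H X & x \in J X.
    case/JP=> [|[X HX Xx]]; [by left|right; exists X => //].
    by apply/JP; right.
  have UJ X x : H X -> x \in J X -> x \in J (\bigcup_(X in H) X)%classic.
    move=> HX /JP[Ix|Xx]; apply/JP; [by left|right; by exists X].
  split; last first.
    apply/negP => /JU[|[X /HP[_ /negP]]] //; exact/negP.
  split=> [|a u v /JU uJ /JU vJ]; first by apply/JP; left.
  have one X : H X -> u \in J X -> v \in J X ->
      a * u + v \in J (\bigcup_(X in H) X)%classic.
    move=> HX uX vX; apply: (UJ X) => //.
    by have [[_ XB] _] := HP _ HX; apply: XB.
  case: uJ vJ => [uI|[X HX uX]] [vI|[Y HY vY]].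
  - by apply/JP; left; apply: IB.
  - by apply: (one Y) => //; apply/JP; left.
  - by apply: (one X) => //; apply/JP; left.
  have [XY|YX] := Htot X Y HX HY.
    apply: (one Y) => //; case/JP: uX => [uI|uX]; apply/JP; first by left.
    by right; apply: XY.
  apply: (one X) => //; case/JP: vY => [vI|vY]; apply/JP; first by left.
  by right; apply: YX.
have Jmax : maximal_ideal (J A).
  split=> // B Bid B1 AB x xB; apply: contrapT => /negP xA.
  pose SB : set R := fun y => y \in B.
  have AB' : (A `<` SB)%classic.
    split=> [y Ay|BA]; first by apply/AB/JP; right.
    by case/negP: xA; apply/JP; right; apply: BA.
  have JB : J SB = B.
    apply/funext => y; apply/asboolP/idP => [[yI|//]|]; last by right.
    by apply/AB/JP; left.
  by apply: (Amax _ AB'); rewrite /P JB.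
exists (MaxSpec Jmax) => x xI; apply/JP; by left.
Qed.

End MaximalIdeals.

(** * Extended modules and the global statement *)

Lemma dilate1 (R : comPzRingType) (sigma : {rmorphism R -> R}) n f :
  dilate sigma n 1 f = f.
Proof. by apply/malgP => a; rewrite ore_twistE skew_exp1 mulr1. Qed.

Lemma dilate0 (R : comPzRingType) (sigma : {rmorphism R -> R}) n f :
  dilate sigma n 0 f = oreC n sigma (ore_aug n sigma f).
Proof.
apply/malgP => a; rewrite ore_twistE skew_exp0 mdeg_eq0 oreU_coeff.
rewrite [mone == a]eq_sym; case: (a =P mone) => [->|_]; last by rewrite mulr0.
by rewrite mulr1.
Qed.

Section Extended.
Context (R : comPzRingType) (n : nat) (sigma : {rmorphism R -> R}).

(** If [M] is extended from [N], base change along the augmentation recovers [N], because the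
    augmentation splits [oreC]. So the constant terms of [K] present [N]. *)
Lemma extended_presented (M : lmodType (ore n sigma)) p q
    (K : 'M[ore n sigma]_(p, q)) :
  presented K M -> extended_from (oreC n sigma) M ->
  exists L : 'M[R]_(p, q), mx_equiv K (map_mx (oreC n sigma) L).
Proof.
move=> KM [N MN].
pose aug : {rmorphism ore n sigma -> R} := ore_aug n sigma.
have N_iso : module_iso (tensor aug M) N.
  apply: module_iso_trans (tensor_iso aug MN) _.
  apply: module_iso_trans (tensor_id (phi := idfun) N _) => //.
  by apply: tensor_comp => r; apply: (esym (ore_augC n sigma r)).
have LN := presented_iso N_iso (presented_tensor aug KM).
exists (map_mx aug K).
exact/(presented_equiv KM (presented_tensor (oreC n sigma) LN)).
Qed.

End Extended.

Theorem theorem4p4 (R : comPzRingType) (n : nat) (sigma : {rmorphism R -> R})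
    (sigma_bij : bijective sigma)
    (sigma_max : forall (m : max_spec R) (s : R),
       s \notin m -> sigma s \notin m)
    (M : lmodType (ore n sigma)) (M_fp : finitely_presented M) :
  extended_from (oreC n sigma) M <->
  forall m : max_spec R,
    extended_from (oreC n (endo_max (sigma_max m)))
      (tensor (ore_max n (sigma_max m)) M).
Proof.
split=> [[N MN] m|Mloc].
  (* The maps from [R] through [A] and through the local ring to the localized Ore extension
     coincide, so both iterated extensions of [N] are its extension along [chi]. *)
  exists (tensor (loc_of (max_compl m)) N).
  apply: module_iso_trans (tensor_iso _ MN) _.
  pose chi : {rmorphism R -> ore n (endo_max (sigma_max m))} :=
    (oreC n (endo_max (sigma_max m)) \o loc_of (max_compl m)).
  apply: module_iso_trans (tensor_comp (chi := chi) N _) _.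
    by move=> r; rewrite /chi /= [RHS]ore_locC.
  by apply/module_iso_sym/tensor_comp.
have [p [q [K KM]]] : exists p q (K : 'M_(p, q)), presented K M.
  by case: M_fp => p [q [K Kf]]; exists p, q, K.
pose I : {pred R} := fun s => `[< forall c r,
  mx_equiv (map_mx (dilate sigma n (c + s * r)) K)
           (map_mx (dilate sigma n c) K) >].
have IP s : reflect (forall c r, mx_equiv
    (map_mx (dilate sigma n (c + s * r)) K) (map_mx (dilate sigma n c) K))
    (s \in I) by apply: asboolP.
have Iid : ideal I.
  split=> [|a u v /IP uI /IP vI]; apply/IP => c r.
    by rewrite mul0r addr0; apply: mx_equiv_refl.
  (* The equivalence passes through the intermediate dilation by [c + u * (a * r)]. *)
  have -> : c + (a * u + v) * r = c + u * (a * r) + v * r by ring.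
  exact: mx_equiv_trans (vI _ _) (uI _ _).
have I1 : 1 \in I.
  apply: contrapT => /negP I1; have [m Im] := ideal_sub_max Iid I1.
  have [L KL] := extended_presented
    (presented_tensor (ore_max n (sigma_max m)) KM) (Mloc m).
  (* The ring is nonzero because it has the proper ideal [m]. *)
  have [F _] : exists _ : param_ring sigma, True.
    apply: param_ring_exists; have [[m0 _] m1 _] := max_specP m.
    by apply: contraNneq m1 => ->.
  have [s sm sK] := mx_equiv_dilate sigma_bij F KL.
  by case/negP: sm; apply/Im/IP.
have K0 : mx_equiv K (map_mx (oreC n sigma) (map_mx (ore_aug n sigma) K)).
  (* With [c = 0] and [r = 1] this compares the dilation by 1, the identity, with the dilation by 0,
     which keeps only constant terms. *)
  move/IP: I1 => /(_ 0 1); rewrite mul1r add0r.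
  have -> : map_mx (dilate sigma n 1) K = K.
    by apply/matrixP => i j; rewrite mxE dilate1.
  have -> // : map_mx (dilate sigma n 0) K =
      map_mx (oreC n sigma) (map_mx (ore_aug n sigma) K).
  by apply/matrixP => i j; rewrite !mxE dilate0.
exists (coker (map_mx (ore_aug n sigma) K)).
by apply/(presented_equiv KM (presented_tensor _ (presented_coker _))).
Qed.
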